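(* For a skew-symmetric operator $\Delta$ in $U_n$ commuting with $\hat h$, let $\{\cdot,\cdot\}_{\Delta,n}$ be the Poisson bracket on $L\mathfrak{gl}_n$ $$\{\hat\varphi,\hat\psi\}_{\Delta,n}=\left\langle\left\langle\begin{pmatrix}\hat r_{\Delta,n}&-\hat h(\hat r_{\Delta,n})_+\\(\hat r_{\Delta,n})_-\hat h^{-1}&-\hat r_{\Delta,n}\end{pmatrix}\begin{pmatrix}\nabla\hat\varphi\\\nabla'\hat\varphi\end{pmatrix},\begin{pmatrix}\nabla\hat\psi\\\nabla'\hat\psi\end{pmatrix}\right\rangle\right\rangle,$$ where $\hat r_{\Delta,n}=\tfrac12(\mathcal P_+-\mathcal P_-)+\left(\frac12\frac{1+\hat h\hat\tau_n}{1-\hat h\hat\tau_n}\mathcal P_0'+n\Delta\,\mathcal P_{U_n}\right)\mathcal P_0$ and $(\hat r_{\Delta,n})_\pm=\hat r_{\Delta,n}\pm\frac12\mathrm{id}$. The only one of the brackets $\{\cdot,\cdot\}_{\Delta,n}$ which gives rise (via Drinfeld-Sokolov reduction) to a Poisson bracket on $\mathbb M_n$ satisfying the involutivity condition, i.e. of the form $$\{\varphi,\psi\}=\left\langle\left\langle\begin{pmatrix}R+a P_0 & b P_0 \\ c P_0 & R+d P_0\end{pmatrix}D\varphi,D\psi\right\rangle\right\rangle\quad\text{with}\quad a+b=c+d,$$ is $\{\cdot,\cdot\}_{0,n}$ (that is, $\Delta=0$).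
   Context: Fix $q\in\mathbb C$, $0<|q|<1$. $\mathbb C((z^{-1}))$ is the field of formal series $a=\sum_{i\le N}a_iz^i$; $(\hat ha)(z)=a(qz)$, also written ${}^ha$; $\int a(z)\,dz/z:=a_0$. $\hat h$ acts on matrices entrywise. $L\mathfrak{gl}_n$ is the algebra of $n\times n$ matrices over $\mathbb C((z^{-1}))$ with inner product $\langle A,B\rangle=\int\frac{dz}{z}\mathrm{Tr}\,A(z)B(z)$. $\mathcal P_+,\mathcal P_-,\mathcal P_0$ are the projections onto strictly upper triangular, strictly lower triangular and diagonal ($L\mathfrak h_n$) matrices. $\mathcal P_{00}$ is the orthogonal projection onto $\mathbb C\cdot1\subset L\mathfrak h_n$ (constant multiples of the unit matrix), $\mathcal P_0'=\mathcal P_0-\mathcal P_{00}$. $\hat\tau_n\,\mathrm{diag}(f_0,\dots,f_{n-1})=\mathrm{diag}(f_1,\dots,f_{n-1},f_0)$; $1-\hat h\hat\tau_n$ is invertible on $\mathcal P_0'(L\mathfrak h_n)$ and $\frac{1+\hat h\hat\tau_n}{1-\hat h\hat\tau_n}\mathcal P_0'$ is understood using this inverse. $U_n=\{\mathrm{diag}(f_0(z),f_0(q^{-1}z),\dots,f_0(q^{-(n-1)}z)):f_0\in\mathbb C((z^{-1}))\}$, $\mathcal P_{U_n}$ is the orthogonal projection onto it. Skew-symmetry is with respect to $\langle\cdot,\cdot\rangle$. A smooth functional $\hat\varphi$ on $L\mathfrak{gl}_n$ has a linear gradient $d\hat\varphi(\mathbb L)\in L\mathfrak{gl}_n$ with $\langle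 d\hat\varphi(\mathbb L),X\rangle=\frac{d}{dt}\big|_{t=0}\hat\varphi(\mathbb L+tX)$; $\nabla\hat\varphi=\mathbb L\,d\hat\varphi$, $\nabla'\hat\varphi=d\hat\varphi\,\mathbb L$. On a direct sum of two copies of a space with inner product, $\langle\langle(X_1,X_2)^T,(Y_1,Y_2)^T\rangle\rangle=\langle X_1,Y_1\rangle-\langle X_2,Y_2\rangle$. DS reduction: the group $L\mathbf N_+(n)$ of unipotent upper triangular matrices over $\mathbb C((z^{-1}))$ acts by $\mathbb L\mapsto{}^hS\,\mathbb L\,S^{-1}$; it preserves $\mathbb Y_n=\{\Lambda_n+A:A\text{ upper triangular}\}$, $\Lambda_n$ having ones on the first subdiagonal and zeros elsewhere. The action on $\mathbb Y_n$ is free with cross-section the companion matrices, with first row $(-u_1,\dots,-u_n)$, ones on the first subdiagonal, zeros elsewhere. Thus $\mathbb Y_n/L\mathbf N_+(n)$ is identified with $\mathbb M_n=\{L=D^n+u_1(z)D^{n-1}+\cdots+u_n(z):u_i\in\mathbb C((z^{-1}))\}$, the companion matrix corresponding to $L$; let $\rho:\mathbb Y_n\to\mathbb M_n$ be the projection. The reduced bracket on $\mathbb M_n$ is $\{\varphi,\psi\}(\rho(\mathbb L))=\{\hat\varphi,\hat\psi\}(\mathbb L)$, $\mathbb L\in\mathbb Y_n$, where $\hat\varphi,\hat\psi$ are $L\mathbf N_+(n)$-invariant functionals on $L\mathfrak{gl}_n$ with $\hat\varphi|_{\mathbb Y_n}=\rho^*\varphi$, $\hat\psi|_{\mathbb Y_n}=\rho^*\psi$.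 $\mathbb M_n$ is regarded as an affine subspace of the algebra $\Psi\mathbf D_q$ of formal series $A=\sum_{i\le N(A)}a_i(z)D^i$, $a_i\in\mathbb C((z^{-1}))$, with $D\cdot a={}^ha\cdot D$. $P_+,P_0,P_-$ are the projections of $\Psi\mathbf D_q$ onto the subalgebras $J_+$, $J_0=\mathbb C((z^{-1}))$, $J_-$ of series with only positive, zero, negative powers of $D$; $R=\frac12(P_+-P_-)$; $a,b,c,d$ are linear operators in $J_0$ with $a=-a^*$, $d=-d^*$, $c^*=b$ (adjoints with respect to $\int fg\,dz/z$). $\mathrm{Tr}\,A=\int P_0A\,dz/z$ and $\langle A,B\rangle=\mathrm{Tr}\,AB$. For a smooth functional $\varphi$ on $\mathbb M_n$, the gradient $d\varphi(L)=\sum_{i=0}^{n-1}f_iD^{-i}$, $f_i\in\mathbb C((z^{-1}))$, is defined by $\langle X,d\varphi(L)\rangle=\frac{d}{dt}\big|_{t=0}\varphi(L+tX)$ for $X=\sum_{i=0}^{n-1}x_iD^i$; $\nabla\varphi=L\,d\varphi$, $\nabla'\varphi=d\varphi\,L$, $D\varphi=(\nabla\varphi,\nabla'\varphi)^T$. *)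

(* Defs.v *)
From HB Require Import structures.
From mathcomp Require Import all_boot all_order all_algebra.
From mathcomp Require Import complex.
From mathcomp Require Import all_classical all_reals all_analysis.
From mathcomp Require Import zify ring.

Set Implicit Arguments.
Unset Strict Implicit.
Unset Printing Implicit Defensive.

Import Order.TTheory GRing.Theory Num.Theory.
Import numFieldNormedType.Exports.

Local Open Scope classical_set_scope.
Local Open Scope ring_scope.

(* Formal series [sum_(i <= N) a_i T^i] with coefficients in V. *)
Record series (V : zmodType) := Series {
  coefs :> int -> V;
  coefs_bounded : exists N : int, forall i, N < i -> coefs i = 0 }.

HB.instance Definition _ (V : zmodType) := gen_eqMixin (series V).
HB.instance Definition _ (V : zmodType) := gen_choiceMixin (series V).

Lemma seriesP (V : zmodType) (a b : series V) : (forall i, a i = b i) -> a = b.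
Proof.
case: a b => [a ha] [b hb] /= /funext eab; subst b.
by congr Series; exact: Prop_irrelevance.
Qed.

Section SeriesModule.
Variable V : zmodType.
Implicit Types a b : series V.

Fact series0_bounded : exists N : int, forall i, N < i -> (0 : V) = 0.
Proof. by exists 0. Qed.

Fact seriesN_bounded a : exists N : int, forall i, N < i -> - a i = 0.
Proof.
by have [N aN] := coefs_bounded a; exists N => i /aN ->; rewrite oppr0.
Qed.

Fact seriesD_bounded a b : exists N : int, forall i, N < i -> a i + b i = 0.
Proof.
have [N aN] := coefs_bounded a; have [M bM] := coefs_bounded b.
exists (Num.max N M) => i; rewrite gt_max => /andP[/aN -> /bM ->].
by rewrite addr0.
Qed.

Definition series0 : series V := Series series0_bounded.
Definition seriesN a : series V := Series (seriesN_bounded a).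
Definition seriesD a b : series V := Series (seriesD_bounded a b).

Fact seriesDA : associative seriesD.
Proof. by move=> a b c; apply: seriesP => i /=; rewrite addrA. Qed.
Fact seriesDC : commutative seriesD.
Proof. by move=> a b; apply: seriesP => i /=; rewrite addrC. Qed.
Fact series0D : left_id series0 seriesD.
Proof. by move=> a; apply: seriesP => i /=; rewrite add0r. Qed.
Fact seriesND : left_inverse series0 seriesN seriesD.
Proof. by move=> a; apply: seriesP => i /=; rewrite addNr. Qed.

HB.instance Definition _ :=
  GRing.isZmodule.Build (series V) seriesDA seriesDC series0D seriesND.

Fact monomial_bounded (x : V) (k : int) :
  exists N : int, forall i, N < i -> (if i == k then x else 0) = 0.
Proof. by exists k => i; rewrite lt_neqAle eq_sym => /andP[/negPf ->]. Qed.

Definition monomial (x : V) (k : int) : series V :=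
  Series (monomial_bounded x k).

Fact restrict_bounded (p : pred int) a :
  exists N : int, forall i, N < i -> (if p i then a i else 0) = 0.
Proof.
by have [N aN] := coefs_bounded a; exists N => i /aN ->; rewrite if_same.
Qed.

Definition restrict (p : pred int) a : series V := Series (restrict_bounded p a).

End SeriesModule.

Section SeriesLmodule.
Variables (K : nzRingType) (V : lmodType K).
Implicit Types a b : series V.

Fact seriesZ_bounded (c : K) a : exists N : int, forall i, N < i -> c *: a i = 0.
Proof.
by have [N aN] := coefs_bounded a; exists N => i /aN ->; rewrite scaler0.
Qed.

Definition seriesZ c a : series V := Series (seriesZ_bounded c a).

Fact seriesZA c d a : seriesZ c (seriesZ d a) = seriesZ (c * d) a.
Proof. by apply: seriesP => i /=; rewrite scalerA. Qed.
Fact series1Z : left_id 1 seriesZ.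
Proof. by move=> a; apply: seriesP => i /=; rewrite scale1r. Qed.
Fact seriesZDr : right_distributive seriesZ +%R.
Proof. by move=> c a b; apply: seriesP => i /=; rewrite scalerDr. Qed.
Fact seriesZDl a : {morph seriesZ^~ a : c d / c + d}.
Proof. by move=> c d; apply: seriesP => i /=; rewrite scalerDl. Qed.

HB.instance Definition _ := GRing.Zmodule_isLmodule.Build K (series V)
  seriesZA series1Z seriesZDr seriesZDl.

End SeriesLmodule.

Section FiniteSums.
Variable V : zmodType.

Lemma fsum_supp (D : set int) (F : int -> V) : (forall i, ~ D i -> F i = 0) ->
  \sum_(i \in [set: int]) F i = \sum_(i \in D) F i.
Proof.
by move=> F0; apply/esym/fsbig_widen => // i [_ /= Di]; exact: F0.
Qed.

Lemma finite_itv_int (m M : int) : finite_set [set i : int | m <= i <= M].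
Proof.
apply: (@sub_finite_set _ _ [set m + (k%:Z) | k in `I_(`|M - m|.+1)]); last first.
  by apply: finite_image; exact: finite_II.
by move=> i /= iB; exists `|i - m|%N => /=; lia.
Qed.

End FiniteSums.

Section Laurent.
Variable R : realType.
Local Notation C := R[i].

(* The field C((z^-1)), set up as a commutative ring with units only. *)
Definition laurent : Type := series C^o.

HB.instance Definition _ := GRing.Lmodule.on laurent.

Implicit Types a b : laurent.

Fact laurentM_bounded a b : exists N : int, forall k, N < k ->
  \sum_(i \in [set: int]) (a i * b (k - i) : C) = 0.
Proof.
have [N aN] := coefs_bounded a; have [M bM] := coefs_bounded b.
exists (N + M) => k ltk; apply: fsbig1 => i _.
have [/aN ->|leiN] := ltP N i; first by rewrite mul0r.
by rewrite bM ?mulr0//; lia.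
Qed.

Definition laurentM a b : laurent := @Series C^o _ (laurentM_bounded a b).
Definition laurent1 : laurent := monomial (1 : C^o) 0.

Fact laurentMC : commutative laurentM.
Proof.
move=> a b; apply: seriesP => k /=.
rewrite (reindex_fsbigT (fun i : int => k - i)); last first.
  by exists (fun i : int => k - i) => i; lia.
apply: eq_fsbigr => i _; rewrite mulrC; congr (_ * _).
by congr (b _); lia.
Qed.

Fact laurentMA : associative laurentM.
Proof.
move=> a b c; apply: seriesP => k /=.
have [A aA] := coefs_bounded a; have [B bB] := coefs_bounded b.
have [G cG] := coefs_bounded c.
pose D := [set i : int | k - G - B <= i <= A].
pose E := [set i : int | k - G <= i <= A + B].
have finD : finite_set D by exact: finite_itv_int.
have finE : finite_set E by exact: finite_itv_int.
transitivity (\sum_(i \in D) \sum_(j \in E) (a i * b (j - i) * c (k - j) : C)).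
  rewrite (@fsum_supp _ D); last first.
    move=> i Di; have [/aA ->|leiA] := ltP A i; first by rewrite mul0r.
    rewrite fsbig1 ?mulr0// => j _.
    have [/bB ->|lejB] := ltP B j; first by rewrite mul0r.
    by rewrite cG ?mulr0//; move: Di; rewrite /D /=; lia.
  apply: eq_fsbigr => i; rewrite inE => Di.
  rewrite (reindex_fsbigT (fun j : int => j - i)); last first.
    by exists (fun j : int => j + i) => j; lia.
  rewrite mulr_fsumr (@fsum_supp _ E); last first.
    move=> j Ej; have [/bB ->|leB] := ltP B (j - i); first by rewrite mul0r mulr0.
    by rewrite cG ?mulr0//; move: Di Ej; rewrite /D /E /=; lia.
  apply: eq_fsbigr => j _; rewrite mulrA; congr (_ * _).
  by congr (c _); lia.
rewrite exchange_fsbig// (@fsum_supp _ E); last first.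
  move=> j Ej; have [/cG ->|lecG] := ltP G (k - j); first by rewrite mulr0.
  rewrite fsbig1 ?mul0r// => i _.
  have [/aA ->|leiA] := ltP A i; first by rewrite mul0r.
  by rewrite bB ?mulr0//; move: Ej; rewrite /E /=; lia.
apply: eq_fsbigr => j; rewrite inE => Ej.
rewrite (@fsum_supp _ D) ?mulr_fsuml// => i Di.
have [/aA ->|leiA] := ltP A i; first by rewrite mul0r.
by rewrite bB ?mulr0//; move: Di Ej; rewrite /D /E /=; lia.
Qed.

Fact laurent1M : left_id laurent1 laurentM.
Proof.
move=> a; apply: seriesP => k /=.
rewrite (@fsum_supp _ [set 0 : int]) ?fsbig_set1 ?eqxx ?mul1r ?subr0// => i /eqP.
by move=> /negPf ->; rewrite mul0r.
Qed.

Fact laurentMDl : left_distributive laurentM +%R.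
Proof.
move=> a b c; apply: seriesP => k /=.
have [A aA] := coefs_bounded a; have [B bB] := coefs_bounded b.
have [G cG] := coefs_bounded c.
pose D := [set i : int | k - G <= i <= Num.max A B].
have finD : finite_set D by exact: finite_itv_int.
have DP (i : int) : ~ D i -> G < k - i \/ (A < i /\ B < i).
  by rewrite /D /=; lia.
rewrite !(@fsum_supp _ D) -?fsbig_split//.
- by apply: eq_fsbigr => i _; rewrite mulrDl.
- by move=> i /DP[/cG ->|[_ /bB ->]]; rewrite ?mulr0 ?mul0r.
- by move=> i /DP[/cG ->|[/aA -> _]]; rewrite ?mulr0 ?mul0r.
- by move=> i /DP[/cG ->|[/aA -> /bB ->]]; rewrite ?mulr0 ?addr0 ?mul0r.
Qed.

Fact laurent1_neq0 : laurent1 != 0.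
Proof.
apply/eqP => /(congr1 (fun a : laurent => a 0)) /= /eqP.
by rewrite oner_eq0.
Qed.

HB.instance Definition _ := GRing.Zmodule_isComNzRing.Build laurent
  laurentMA laurentMC laurent1M laurentMDl laurent1_neq0.

Definition laurent_unit : pred laurent := fun a => `[< exists b, b * a = 1 >].
Definition laurentV a : laurent := xget a [set b | b * a = 1].

Fact laurentVM : {in laurent_unit, left_inverse 1 laurentV *%R}.
Proof. by move=> a /asboolP[b ba1]; exact: (@xgetI _ _ [set c | c * a = 1] b). Qed.

Fact laurent_unitP a b : b * a = 1 -> laurent_unit a.
Proof. by move=> ba1; apply/asboolP; exists b. Qed.

Fact laurentV_out : {in [predC laurent_unit], laurentV =1 id}.
Proof.
by move=> a /asboolPn ab; rewrite /laurentV xgetPN// => b ba1; apply: ab; exists b.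
Qed.

HB.instance Definition _ := GRing.ComNzRing_hasMulInverse.Build laurent
  laurentVM laurent_unitP laurentV_out.

Definition laurentC (c : C) : laurent := monomial (c : C^o) 0.

(* [zint a] is the integral of [a(z) dz/z]. *)
Definition zint a : C := a 0.

Fact dil_bounded (c : C) a :
  exists N : int, forall i, N < i -> (c ^ i * a i : C) = 0.
Proof.
by have [N aN] := coefs_bounded a; exists N => i /aN ->; rewrite mulr0.
Qed.

(* [(dil c a)(z) = a(c z)]; thus [dil q] is the shift operator and, for q != 0, *)
(* [dil q^-1] is its inverse.                                                   *)
Definition dil (c : C) a : laurent := @Series C^o _ (dil_bounded c a).

Definition adjoint (f g : laurent -> laurent) : Prop :=
  forall u v, zint (f u * v) = zint (u * g v).

End Laurent.

Section LoopAlgebra.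
Variables (R : realType) (q : R[i]) (n : nat).
Local Notation C := R[i].
Local Notation L := (laurent R).
Local Notation gl := 'M[laurent R]_n.
Implicit Types A B X : gl.

Definition pairing A B : C := zint (\tr (A *m B)).

Definition shift (c : C) A : gl := map_mx (dil c) A.
Local Notation h := (shift q).
Local Notation hV := (shift q^-1).

Definition proj_upper A : gl := \matrix_(i, j) if (i < j)%N then A i j else 0.
Definition proj_lower A : gl := \matrix_(i, j) if (j < i)%N then A i j else 0.
Definition proj_diag A : gl := diag_mx (\row_i A i i).

Definition orth_proj (U : set gl) A : gl :=
  xget 0 [set B | U B /\ forall D, U D -> pairing (A - B) D = 0].

Definition scalars : set gl := [set (laurentC c)%:M | c in [set: C]].
Definition proj_00 : gl -> gl := orth_proj scalars.
Definition proj_0' A : gl := proj_diag A - proj_00 (proj_diag A).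

(* [ordS i] is the cyclic successor of i. *)
Definition tau A : gl := diag_mx (\row_i A (ordS i) (ordS i)).

(* The inverse of [1 - h tau] on the image of [proj_0'] *)
Definition inv_1_htau A : gl :=
  xget 0 [set B | range proj_0' B /\ B - h (tau B) = A].

Definition cayley A : gl := inv_1_htau A + h (tau (inv_1_htau A)).

Definition Uspace : set gl :=
  [set diag_mx (\row_i dil (q ^- i) f) | f in [set: L]].

(* Operators in U_n are represented by maps of the whole matrix algebra, of which *)
(* only the values on U_n matter.                                                 *)
Definition operator_in_U (Delta : gl -> gl) : Prop :=
  (forall A, Uspace A -> Uspace (Delta A)) /\
  (forall (c : C) A B, Uspace A -> Uspace B ->
     Delta (laurentC c *: A + B) = laurentC c *: Delta A + Delta B).

Definition skew_in_U (Delta : gl -> gl) : Prop :=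
  forall A B, Uspace A -> Uspace B ->
    pairing (Delta A) B = - pairing A (Delta B).

Definition commutes_with_shift_in_U (Delta : gl -> gl) : Prop :=
  forall A, Uspace A -> Delta (h A) = h (Delta A).

Definition half : L := laurentC (2^-1).

Section Bracket.
Variable Delta : gl -> gl.

Definition rmat A : gl :=
  half *: (proj_upper A - proj_lower A)
  + (half *: cayley (proj_0' (proj_diag A))
     + Delta (orth_proj Uspace (proj_diag A)) *+ n).
Definition rmat_plus A : gl := rmat A + half *: A.
Definition rmat_minus A : gl := rmat A - half *: A.

(* The derivative is taken along the complex line [t |-> A + tX], t : C. *)
Definition is_grad_gl (phi : gl -> C) (A G : gl) : Prop :=
  forall X, is_derive (0 : C^o) (1 : C^o)
    (fun t : C^o => phi (A + laurentC t *: X) : C^o) (pairing G X).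
Definition smooth_gl (phi : gl -> C) : Prop := forall A, exists G, is_grad_gl phi A G.
Definition grad_gl (phi : gl -> C) A : gl := xget 0 (is_grad_gl phi A).

Definition bracket_gl (phi psi : gl -> C) (A : gl) : C :=
  let N1 := A *m grad_gl phi A in
  let N1' := grad_gl phi A *m A in
  let N2 := A *m grad_gl psi A in
  let N2' := grad_gl psi A *m A in
  pairing (rmat N1 - h (rmat_plus N1')) N2
  - pairing (rmat_minus (hV N1) - rmat N1') N2'.

End Bracket.

Definition LNplus : set gl :=
  [set S | forall i j : 'I_n, (j <= i)%N -> S i j = (i == j)%:R].

Definition gauge (S A : gl) : gl := h S *m A *m invmx S.

Definition gauge_invariant (phi : gl -> C) : Prop :=
  forall S A, LNplus S -> phi (gauge S A) = phi A.

(* Lambda_n + upper triangular matrices, the diagonal being included *)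
Definition Yspace : set gl :=
  [set A | forall i j : 'I_n, (j < i)%N -> A i j = (i == j.+1 :> nat)%:R].

End LoopAlgebra.

Section DifferenceOperators.
Variables (R : realType) (q : R[i]).
Local Notation C := R[i].
Local Notation L := (laurent R).

(* A : psiD stands for [sum_(i <= N) A_i D^i]. *)
Definition psiD : Type := series (laurent R).
HB.instance Definition _ := GRing.Lmodule.on psiD.

Implicit Types A B X : psiD.

Fact psiM_bounded A B : exists N : int, forall k, N < k ->
  \sum_(i \in [set: int]) (A i * dil (q ^ i) (B (k - i))) = 0.
Proof.
have [N aN] := coefs_bounded A; have [M bM] := coefs_bounded B.
exists (N + M) => k ltk; apply: fsbig1 => i _.
have [/aN ->|leiN] := ltP N i; first by rewrite mul0r.
rewrite bM; last by lia.
by rewrite [dil _ _](_ : _ = 0) ?mulr0//; apply: seriesP => j /=; rewrite mulr0.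
Qed.

(* The product determined by [D * a = (dil q a) * D] *)
Definition psiM A B : psiD := Series (psiM_bounded A B).

Definition psi_trace A : C := zint (A 0).
Definition psi_pairing A B : C := psi_trace (psiM A B).

Definition psi_plus A : psiD := restrict (fun i => 0 < i) A.
Definition psi_minus A : psiD := restrict (fun i => i < 0) A.
Definition psi_R A : psiD := (2^-1 : C) *: (psi_plus A - psi_minus A).
(* [psi_0 f A] is [f (P_0 A)], an element of J_0 *)
Definition psi_0 (f : L -> L) A : psiD := monomial (f (A 0)) 0.

Definition supported (p : pred int) : set psiD :=
  [set A : psiD | forall i, ~~ p i -> A i = 0].

Variable n : nat.

Definition Mspace : set psiD :=
  [set A : psiD | A n%:Z = 1 /\ supported (fun i => 0 <= i <= n%:Z) A].

Definition is_grad_M (phi : psiD -> C) A (F : psiD) : Prop :=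
  supported (fun i => - n%:Z < i <= 0) F /\
  forall X, supported (fun i => 0 <= i < n%:Z) X ->
    is_derive (0 : C^o) (1 : C^o)
      (fun t : C^o => phi (A + (t : C) *: X) : C^o) (psi_pairing X F).
Definition smooth_M (phi : psiD -> C) : Prop :=
  forall A, Mspace A -> exists F, is_grad_M phi A F.
Definition grad_M (phi : psiD -> C) A : psiD := xget 0 (is_grad_M phi A).

Definition bracket_M (a b c d : L -> L) (phi psi : psiD -> C) A : C :=
  let N1 := psiM A (grad_M phi A) in
  let N1' := psiM (grad_M phi A) A in
  let N2 := psiM A (grad_M psi A) in
  let N2' := psiM (grad_M psi A) A in
  psi_pairing (psi_R N1 + psi_0 a N1 + psi_0 b N1') N2
  - psi_pairing (psi_0 c N1 + (psi_R N1' + psi_0 d N1')) N2'.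

Definition involutive_form (br : (psiD -> C) -> (psiD -> C) -> psiD -> C) : Prop :=
  exists a b c d : {linear L -> L},
  [/\ adjoint a (fun f => - a f), adjoint d (fun f => - d f), adjoint c b,
      forall f, a f + b f = c f + d f
    & forall phi psi, smooth_M phi -> smooth_M psi ->
        forall A, Mspace A -> br phi psi A = bracket_M a b c d phi psi A].

(* With [A = D^n + u_1 D^(n-1) + ... + u_n], the first row is (-u_1, ..., -u_n). *)
Definition companion A : 'M[L]_n :=
  \matrix_(i, j) if i == 0 :> nat then - A (n%:Z - j%:Z - 1)
                 else (i == j.+1 :> nat)%:R.

Definition rho (A : 'M[L]_n) : psiD :=
  xget 0 [set B | Mspace B /\ exists2 S, LNplus S & gauge q S A = companion B].

Definition extends (phi : psiD -> C) (hphi : 'M[L]_n -> C) : Prop :=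
  [/\ smooth_gl hphi, gauge_invariant q hphi
    & forall A : 'M[L]_n, Yspace A -> hphi A = phi (rho A)].

Definition DS_reduction (Delta : 'M[L]_n -> 'M[L]_n)
    (br : (psiD -> C) -> (psiD -> C) -> psiD -> C) : Prop :=
  forall phi psi hphi hpsi, smooth_M phi -> smooth_M psi ->
    extends phi hphi -> extends psi hpsi ->
    forall A : 'M[L]_n, Yspace A ->
      br phi psi (rho A) = bracket_gl q Delta hphi hpsi A.

Definition reduces_to_involutive (Delta : 'M[L]_n -> 'M[L]_n) : Prop :=
  exists2 br, DS_reduction Delta br & involutive_form br.

End DifferenceOperators.

(* The projections, inverses and choices made above by [xget] exist and are *)
(* unique: explicit formulas and well-definedness.                          *)
Section LaurentTheory.
Variable R : realType.
Local Notation C := R[i].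
Implicit Types a b : laurent R.

Lemma laurentMCr (c : C) a k : (laurentC c * a : laurent R) k = c * a k.
Proof.
rewrite [LHS](@fsum_supp _ [set 0 : int]) ?fsbig_set1 ?eqxx ?subr0//.
by move=> i /eqP/negPf ni /=; rewrite ni mul0r.
Qed.

Lemma laurentD a b k : (a + b) k = a k + b k. Proof. by []. Qed.
Lemma laurentN a k : (- a) k = - a k. Proof. by []. Qed.
Lemma laurent_sum (I : Type) (r : seq I) (P : pred I) (F : I -> laurent R) k :
  (\sum_(i <- r | P i) F i) k = \sum_(i <- r | P i) F i k.
Proof.
by elim/big_rec2: _ => [|i x y _ <-]//.
Qed.

Fact dil_is_additive (c : C) : zmod_morphism (@dil R c).
Proof. by move=> a b; apply: seriesP => i /=; rewrite mulrBr. Qed.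
HB.instance Definition _ (c : C) :=
  GRing.isZmodMorphism.Build (laurent R) (laurent R) (@dil R c) (@dil_is_additive c).

Lemma zintD a b : zint (a + b) = zint a + zint b. Proof. by []. Qed.

Lemma laurentMn m a k : (a *+ m) k = m%:R * a k.
Proof.
elim: m => [|m IH]; first by rewrite mul0r.
by rewrite !mulrS laurentD IH mulrDl mul1r.
Qed.

Lemma zint_sum (I : Type) (r : seq I) (P : pred I) (F : I -> laurent R) :
  zint (\sum_(i <- r | P i) F i) = \sum_(i <- r | P i) zint (F i).
Proof. exact: laurent_sum. Qed.

Lemma zint_dil (c : C) a : zint (dil c a) = zint a.
Proof. by rewrite /zint /= expr0z mul1r. Qed.

Lemma dil1 (c : C) : dil c (1 : laurent R) = 1.
Proof.
by apply: seriesP => i /=; case: eqP => [->|_]; rewrite ?expr0z ?mul1r ?mulr0.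
Qed.

Lemma dil_comp (c d : C) a : dil c (dil d a) = dil (c * d) a.
Proof. by apply: seriesP => i /=; rewrite mulrA expfzMl. Qed.

Lemma dilK (c : C) : c != 0 -> cancel (dil c^-1) (@dil R c).
Proof.
move=> c0 a; rewrite dil_comp mulfV//.
by apply: seriesP => j /=; rewrite exp1rz mul1r.
Qed.

Lemma dilM (c : C) a b : c != 0 -> dil c (a * b) = dil c a * dil c b.
Proof.
move=> c0; apply: seriesP => k /=; rewrite mulr_fsumr; apply: eq_fsbigr => i _.
rewrite mulrACA -expfzDr//; congr (c ^ _ * _); lia.
Qed.

Lemma zintM_monomial a k : zint (a * (monomial (1 : C^o) k : laurent R)) = a (- k).
Proof.
rewrite [LHS](@fsum_supp _ [set (- k : int)]) ?fsbig_set1 /=.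
  by rewrite sub0r opprK eqxx mulr1.
move=> i /eqP ni /=; rewrite ifF ?mulr0//; apply/negP => /eqP; lia.
Qed.

End LaurentTheory.

Section LoopTheory.
Variables (R : realType) (q : R[i]) (n : nat).
Local Notation C := R[i].
Local Notation gl := 'M[laurent R]_n.
Hypothesis n_gt0 : (0 < n)%N.
Implicit Types A B : gl.

Let n_neq0 : n%:R != 0 :> C. Proof. by rewrite pnatr_eq0 -lt0n. Qed.

Lemma pairing_diag A (d : 'rV[laurent R]_n) :
  pairing A (diag_mx d) = \sum_i zint (A i i * d 0 i).
Proof.
rewrite /pairing mul_mx_diag /mxtrace /zint laurent_sum.
by apply: eq_bigr => i _; rewrite mxE.
Qed.

Lemma pairing_scalar A (c : C) :
  pairing A (laurentC c)%:M = c * \sum_i zint (A i i).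
Proof.
rewrite -diag_const_mx pairing_diag mulr_sumr; apply: eq_bigr => i _.
by rewrite mxE mulrC /zint laurentMCr.
Qed.

Lemma proj_00E A :
  proj_00 A = (laurentC (n%:R^-1 * \sum_i zint (A i i)))%:M.
Proof.
set c := _ * _; rewrite /proj_00 /orth_proj; case: xgetP => [B _ [[b _ <-]] bP|nP].
  congr (laurentC _)%:M.
  have := bP (laurentC 1)%:M; rewrite pairing_scalar mul1r.
  rewrite (eq_bigr (fun i => zint (A i i) - b)); last first.
    by move=> i _; rewrite !mxE eqxx.
  rewrite sumrB sumr_const card_ord => b0.
  have /b0/eqP : scalars ((laurentC 1)%:M : gl) by exists 1.
  by rewrite subr_eq0 /c => /eqP ->; rewrite -[b *+ n]mulr_natl mulKf.
exfalso; apply: (nP (laurentC c)%:M); split; first by exists c.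
move=> _ [d _ <-]; rewrite pairing_scalar.
rewrite (eq_bigr (fun i => zint (A i i) - c)); last first.
  by move=> i _; rewrite !mxE eqxx.
by rewrite sumrB sumr_const card_ord -[c *+ n]mulr_natl mulVKf// subrr mulr0.
Qed.

Lemma zintM_dil (c : C) (a b : laurent R) : c != 0 ->
  zint (a * dil c^-1 b) = zint (dil c a * b).
Proof.
by move=> c0; rewrite -(zint_dil c) dilM// dilK.
Qed.

Lemma orth_proj_UE A : q != 0 ->
  orth_proj (@Uspace R q n) A = diag_mx (\row_i dil (q ^- i)
    (laurentC n%:R^-1 * \sum_(j < n) dil (q ^+ j) (A j j))).
Proof.
move=> q0; set g := \sum_(j < n) _.
have gP (f s : laurent R) :
    pairing (A - diag_mx (\row_i dil (q ^- i) f)) (diag_mx (\row_i dil (q ^- i) s))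
    = zint ((g - f *+ n) * s).
  rewrite pairing_diag /g -[f *+ n](_ : \sum_(j < n) f = _).
    rewrite -sumrB mulr_suml zint_sum; apply: eq_bigr => i _.
    rewrite [(\row__ _) _ _]mxE zintM_dil ?expf_neq0//; congr (zint (_ * _)).
    by rewrite !mxE eqxx mulr1n raddfB /= dilK// expf_neq0.
  by rewrite sumr_const card_ord.
have muln := @laurentMn R n.
rewrite /orth_proj; case: xgetP => [B _ [[f _ <-]] fP|nP].
  congr diag_mx; apply/rowP => i; rewrite !mxE; congr dil.
  apply: seriesP => k; rewrite laurentMCr.
  have := fP (diag_mx (\row_i dil (q ^- i) (monomial (1 : C^o) (- k)))).
  rewrite gP zintM_monomial opprK laurentD laurentN muln => g0.
  have /g0/eqP : @Uspace R q n (diag_mx (\row_i dil (q ^- i)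
      (monomial (1 : C^o) (- k) : laurent R)) : gl).
    by exists (monomial (1 : C^o) (- k)).
  by rewrite subr_eq0 => /eqP ->; rewrite mulKf.
exfalso; apply: (nP (diag_mx (\row_i dil (q ^- i) (laurentC n%:R^-1 * g)))).
split; first by exists (laurentC n%:R^-1 * g).
move=> _ [s _ <-]; rewrite gP (_ : g - _ = 0) ?mul0r//.
by apply: seriesP => k; rewrite laurentD laurentN muln laurentMCr mulVKf// subrr.
Qed.

End LoopTheory.

Section Cayley.
Variables (R : realType) (q : R[i]) (n : nat).
Local Notation C := R[i].
Local Notation L := (laurent R).
Local Notation gl := 'M[laurent R]_n.
Hypotheses (n_gt0 : (0 < n)%N) (q_gt0 : 0 < `|q|) (q_lt1 : `|q| < 1).
Implicit Types A B : gl.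

Let n_neq0 : n%:R != 0 :> C. Proof. by rewrite pnatr_eq0 -lt0n. Qed.
Let q_neq0 : q != 0. Proof. by rewrite -normr_gt0. Qed.

Lemma range_proj_0'P A : range (@proj_0' R n) A <->
  exists2 d, A = diag_mx d & \sum_i d 0 i 0 = 0.
Proof.
split=> [[B _ <-]|[d -> d0]].
  rewrite /proj_0' proj_00E// -diag_const_mx -raddfB /=; eexists; first by [].
  rewrite [X in laurentC (_ * X)](eq_bigr (fun i => B i i 0)); last first.
    by move=> i _; rewrite !mxE eqxx.
  set c := _ * _; rewrite (eq_bigr (fun i => B i i 0 - c)); last first.
    by move=> i _; rewrite !mxE.
  rewrite sumrB sumr_const card_ord /c -[X in _ - X]mulr_natl mulVKf//.
  by rewrite subrr.
exists (diag_mx d) => //; rewrite /proj_0' proj_00E//.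
have dd : proj_diag (diag_mx d) = diag_mx d.
  by congr diag_mx; apply/rowP => i; rewrite !mxE eqxx.
rewrite dd (eq_bigr (fun i => d 0 i 0)); last by move=> i _; rewrite !mxE eqxx.
have C0 : laurentC 0 = 0 :> L by apply: seriesP => i /=; rewrite if_same.
rewrite d0 mulr0 C0 (_ : 0%:M = 0) ?subr0//.
by apply/matrixP => i j; rewrite !mxE mul0rn.
Qed.

Lemma iter_ordS m (i : 'I_n) : iter m (@ordS n) i = ((i + m) %% n)%N :> nat.
Proof.
elim: m => [|m IH]; first by rewrite addn0 modn_small.
by rewrite /= IH -addn1 modnDml addn1 addnS.
Qed.

Lemma iter_ordSn (i : 'I_n) : iter n (@ordS n) i = i.
Proof. by apply: ord_inj; rewrite iter_ordS modnDr modn_small. Qed.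

Lemma qn_neq1 (k : int) : k != 0 -> (q ^ k) ^+ n != 1.
Proof.
move=> k0.
have qm m : (0 < m)%N -> q ^+ m != 1.
  move=> m0; apply/negP => /eqP /(congr1 Num.norm); rewrite normrX normr1 => /eqP.
  by rewrite pexpr_eq1 ?normr_ge0// lt_eqF.
case: k k0 => m m0.
  by rewrite -[q ^ _]/(q ^+ m) -exprM qm// muln_gt0 n_gt0 lt0n andbT.
by rewrite NegzE -exprnN exprVn invr_eq1 -exprM qm// muln_gt0 n_gt0.
Qed.

Lemma htau_diag (d : 'rV[L]_n) : diag_mx d - shift q (tau (diag_mx d)) =
  diag_mx (\row_i (d 0 i - dil q (d 0 (ordS i)))).
Proof.
rewrite /tau /shift; apply/matrixP => i j; rewrite !mxE.
case: eqP => [->|_]; rewrite ?mulr1n ?mulr0n ?eqxx ?raddf0 ?subr0//.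
by rewrite addr0.
Qed.

Lemma cyc_sum (v : 'I_n -> C) i :
  \sum_(j < n) v (iter j (@ordS n) i) = \sum_j v j.
Proof.
pose f (j : 'I_n) := iter j (@ordS n) i.
rewrite [RHS](reindex f)//; apply/onW_bij/injF_bij => j k /(congr1 val)/=.
rewrite !iter_ordS => /eqP; rewrite eqn_modDl !modn_small// => /eqP; exact: val_inj.
Qed.

Definition htau_sol (v : 'I_n -> C) (k : int) (i : 'I_n) : C :=
  if k == 0 then - n%:R^-1 * \sum_(j < n) j%:R * v (iter j (@ordS n) i)
  else (1 - (q ^ k) ^+ n)^-1 * \sum_(j < n) (q ^ k) ^+ j * v (iter j (@ordS n) i).

Lemma htau_solP v k i : (k = 0 -> \sum_j v j = 0) ->
  htau_sol v k i - q ^ k * htau_sol v k (ordS i) = v i.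
Proof.
move=> v0; rewrite /htau_sol; have [k0|k0] := eqVneq k 0.
  rewrite k0 expr0z mul1r -mulrBr.
  have e m : \sum_(j < m) j%:R * v (iter j (@ordS n) i)
      - \sum_(j < m) j%:R * v (iter j (@ordS n) (ordS i))
      = \sum_(j < m) v (iter j (@ordS n) i) - m%:R * v (iter m (@ordS n) i)
        + v (iter m (@ordS n) i) - v i.
    elim: m => [|m IH]; first by rewrite !big_ord0 /= ; ring.
    by rewrite !big_ord_recr /= -iterSr /= opprD addrACA IH -[m.+1%:R]natr1; ring.
  by rewrite e iter_ordSn cyc_sum v0//; field.
have e m : \sum_(j < m) (q ^ k) ^+ j * v (iter j (@ordS n) i)
    - q ^ k * \sum_(j < m) (q ^ k) ^+ j * v (iter j (@ordS n) (ordS i))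
    = v i - (q ^ k) ^+ m * v (iter m (@ordS n) i).
  elim: m => [|m IH]; first by rewrite !big_ord0 /=; ring.
  rewrite !big_ord_recr /= -iterSr /= mulrDr opprD addrACA IH exprS; ring.
rewrite mulrCA -mulrBr e iter_ordSn -{1}[v i]mul1r -mulrBl mulKf//.
by rewrite subr_eq0 eq_sym qn_neq1.
Qed.

Lemma htau_sol_bounded (d : 'rV[L]_n) i :
  exists N : int, forall k, N < k -> (htau_sol (fun j => d 0 j k) k i : C^o) = 0.
Proof.
have [N NP] : exists N : int, forall j k, N < k -> d 0 j k = 0.
  have /choice [N NP] : forall j, exists N : int, forall k, N < k -> d 0 j k = 0.
    by move=> j; exact: coefs_bounded.
  exists (\big[Num.max/0]_j N j) => j k lek; apply: NP.
  by apply: le_lt_trans lek; exact: le_bigmax.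
exists N => k Nk; rewrite /htau_sol; case: ifP => _; rewrite big1 ?mulr0// => j _;
  by rewrite NP ?mulr0.
Qed.

(* [inv_1_htau] is well defined on the image of [proj_0']. *)
Lemma htau_invertible A : range (@proj_0' R n) A ->
  exists! B, range (@proj_0' R n) B /\ B - shift q (tau B) = A.
Proof.
move=> /range_proj_0'P[d -> d0].
pose x : 'rV[L]_n := \row_i (@Series C^o _ (htau_sol_bounded d i) : L).
have xd i : x 0 i - dil q (x 0 (ordS i)) = d 0 i.
  apply: seriesP => k; rewrite laurentD laurentN !mxE /= htau_solP// => ->.
  exact: d0.
have injz (y : 'rV[L]_n) : \sum_i y 0 i 0 = 0 ->
    (forall i, y 0 i = dil q (y 0 (ordS i))) -> y = 0.
  move=> y0 yq; apply/rowP => i; rewrite mxE; apply: seriesP => k.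
  have yk m : y 0 i k = (q ^ k) ^+ m * y 0 (iter m (@ordS n) i) k.
    elim: m => [|m IH]; first by rewrite mul1r.
    by rewrite IH exprSr -mulrA; congr (_ * _); rewrite [in LHS]yq.
  have [k0|k0] := eqVneq k 0; last first.
    have := yk n; rewrite iter_ordSn => /eqP; rewrite -subr_eq0 -{1}[y 0 i k]mul1r.
    by rewrite -mulrBl mulf_eq0 subr_eq0 eq_sym (negPf (qn_neq1 k0)) => /eqP.
  subst k; have := y0; rewrite -(cyc_sum (fun j => y 0 j 0) i).
  rewrite (eq_bigr (fun=> y 0 i 0)); last first.
    by move=> j _; rewrite (yk j) expr0z expr1n mul1r.
  rewrite sumr_const card_ord -mulr_natl => /eqP.
  by rewrite mulf_eq0 (negPf n_neq0) => /eqP.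
have x0 : \sum_i x 0 i 0 = 0.
  under eq_bigr do rewrite mxE /= /htau_sol eqxx.
  rewrite -mulr_sumr exchange_big /= big1 ?mulr0// => j _.
  rewrite -mulr_sumr; have fb : bijective (iter j (@ordS n)).
    apply: injF_bij; elim: (j : nat) => [|m IH] //= a b /ordS_inj; exact: IH.
  move: d0; rewrite (reindex (iter j (@ordS n)))/=; last exact: onW_bij.
  by move=> ->; rewrite mulr0.
exists (diag_mx x); split.
  split; last by rewrite htau_diag; congr diag_mx; apply/rowP => i; rewrite mxE xd.
  by apply/range_proj_0'P; exists x.
move=> B [/range_proj_0'P[y -> y0]]; rewrite htau_diag => yd.
have {}yd i : y 0 i - dil q (y 0 (ordS i)) = d 0 i.
  by move/matrixP: yd => /(_ i i); rewrite !mxE eqxx !mulr1n.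
congr diag_mx; apply/eqP; rewrite -subr_eq0; apply/eqP/injz => [|i].
  rewrite (eq_bigr (fun i => x 0 i 0 - y 0 i 0)) ?sumrB ?x0 ?y0 ?subrr//.
  by move=> i _; rewrite !mxE.
have := xd i; rewrite -(yd i) => /eqP; rewrite subr_eq => /eqP xi.
rewrite [LHS]mxE [X in _ + X]mxE [X in dil q X]mxE [X in dil q (_ + X)]mxE.
by rewrite xi raddfB addrAC [_ - y 0 i]addrC; rewrite /= addrA; ring.
Qed.

End Cayley.

Section Rho.
Variables (R : realType) (q : R[i]) (n : nat).
Local Notation L := (laurent R).
Local Notation gl := 'M[laurent R]_n.+1.
Implicit Types A S T : gl.

Lemma LNplus_unit S : LNplus S -> S \in unitmx.
Proof.
move=> SN; rewrite unitmxE -det_tr det_trig.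
  by rewrite big1 ?unitr1// => i _; rewrite mxE SN ?eqxx.
apply/is_trig_mxP => i j ij; rewrite mxE SN 1?ltnW//.
by rewrite -val_eqE gtn_eqF.
Qed.

Lemma mul_companion (B : psiD R) S (i j : 'I_n.+1) : (0 < i)%N ->
  (companion n.+1 B *m S) i j = S (inord i.-1) j.
Proof.
move=> i0; rewrite mxE (bigD1 (inord i.-1 : 'I_n.+1))//= mxE gtn_eqF//.
rewrite inordK ?prednK ?eqxx ?mul1r//; last by have := ltn_ord i; lia.
rewrite big1 ?addr0// => k kn; rewrite mxE gtn_eqF//.
rewrite (_ : (_ == _) = false) ?mul0r//; apply/negP => /eqP ik.
by move/eqP: kn; apply; apply: val_inj; rewrite /= inordK ?ik//= -ltnS; have := ltn_ord k.
Qed.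

Fixpoint krow A (k : nat) : 'rV[L]_n.+1 :=
  if k is k'.+1 then map_mx (dil q) (krow A k') *m A else delta_mx 0 ord_max.

Lemma krow_unip A k (j : 'I_n.+1) : Yspace A -> (k + j <= n)%N ->
  krow A k 0 j = (k + j == n)%N%:R.
Proof.
move=> YA; elim: k j => [|k IH] j kj.
  by rewrite /= mxE eqxx /= -val_eqE /=.
rewrite /= mxE; have jn : (j.+1 < n.+1)%N by lia.
rewrite (bigD1 (Ordinal jn))//= mxE IH/=; last by lia.
rewrite YA//= eqxx mulr1 addnS -addSn big1 ?addr0//.
  by case: eqP => _; rewrite ?dil1 ?raddf0.
move=> i ij; rewrite mxE.
have [le|lt] := leqP (k + i) n; last first.
  by rewrite YA; [rewrite (_ : (_ == _) = false) ?mulr0//; lia|lia].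
rewrite IH// ; have [ki|ki] := eqVneq (k + i)%N n; last by rewrite raddf0 mul0r.
rewrite YA; last by lia.
rewrite (_ : (_ == _) = false) ?mulr0//; apply/negP => /eqP ik.
by move/eqP: ij; apply; exact: val_inj.
Qed.

Lemma Mspace_bounded (w : 'I_n.+1 -> L) : exists N : int, forall i : int, N < i ->
  (if i == n.+1 then 1 else
   if 0 <= i <= n%:Z then - w (inord `|n%:Z - i|%N) else 0 : L) = 0.
Proof. by exists n.+1 => i ni; rewrite !ifF//; lia. Qed.

(* [rho] is well defined on [Yspace]. *)
Lemma rho_exists A : Yspace A ->
  exists B, Mspace n.+1 B /\ exists2 S, LNplus S & gauge q S A = companion n.+1 B.
Proof.
move=> YA; pose S : gl := \matrix_(i, j) krow A (n - i) 0 j.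
have SN : LNplus S.
  move=> i j ji; rewrite mxE krow_unip//; last by have := ltn_ord i; lia.
  congr (_%:R); congr nat_of_bool; rewrite -val_eqE /=.
  by have := ltn_ord i; lia.
have uS := LNplus_unit SN.
pose w := krow A n.+1 *m invmx S.
pose B : psiD R := Series (Mspace_bounded (w 0)).
exists B; split; first by split=> [|i] /=; [rewrite eqxx|move=> ni; rewrite !ifF//; lia].
exists S => //; rewrite /gauge -[RHS](mulmxK uS); congr (_ *m _).
have rS i : row i (shift q S) = map_mx (dil q) (krow A (n - i)).
  by apply/rowP => j; rewrite !mxE.
apply/row_matrixP => i; rewrite row_mul rS -[LHS]/(krow A (n - i).+1).
have [i0|i0] := eqVneq (i : nat) 0%N; last first.
  apply/rowP => j; rewrite [RHS]mxE mul_companion ?lt0n// [RHS]mxE inordK.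
    by congr (krow A _ _ _); have := ltn_ord i; lia.
  by have := ltn_ord i; lia.
rewrite i0 subn0 row_mul (_ : row i _ = w) ?mulmxKV//.
apply/rowP => j; rewrite 2![LHS]mxE i0 eqxx /= ifF; last by have := ltn_ord j; lia.
rewrite ifT; last by have := ltn_ord j; lia.
rewrite opprK (_ : inord _ = j)//; apply: ord_inj.
by rewrite /= inordK; have := ltn_ord j; lia.
Qed.

Lemma rho_unique A B B' S S' : Mspace n.+1 B -> Mspace n.+1 B' ->
  LNplus S -> LNplus S' ->
  gauge q S A = companion n.+1 B -> gauge q S' A = companion n.+1 B' -> B = B'.
Proof.
move=> MB MB' SN SN'.
have gE T D : LNplus T -> gauge q T A = companion n.+1 D ->
    shift q T *m A = companion n.+1 D *m T.
  by move=> TN <-; rewrite mulmxKV// LNplus_unit.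
move=> /(gE _ _ SN) eS /(gE _ _ SN') eS'.
have SS' k (i : 'I_n.+1) : (n - i = k)%N -> row i S = row i S'.
  elim: k i => [|k IH] i ik.
    have -> : i = ord_max by apply: val_inj => /=; have := ltn_ord i; lia.
    apply/rowP => j; have jn : (j <= @ord_max n)%N by rewrite -ltnS.
    by rewrite !mxE (SN _ _ jn) (SN' _ _ jn).
  have i1n : (i.+1 < n.+1)%N by lia.
  have := IH (Ordinal i1n); rewrite /= => /(_ _) eqr.
  have {}eqr : row (Ordinal i1n) S = row (Ordinal i1n) S' by apply: eqr; lia.
  apply/rowP => j; rewrite !mxE.
  have iE : i = inord (Ordinal i1n).-1 :> 'I_n.+1 by rewrite /= inord_val.
  rewrite iE -(mul_companion B)// -(mul_companion B')// -eS -eS' !mxE.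
  apply: eq_bigr => l _; congr (_ * _); rewrite !mxE; congr (dil q _).
  by move/rowP: eqr => /(_ l); rewrite !mxE.
have {}SS' : S = S' by apply/row_matrixP => i; exact: SS' erefl.
subst S'; have : companion n.+1 B = companion n.+1 B'.
  by apply: (can_inj (mulmxK (LNplus_unit SN))); rewrite -eS -eS'.
move=> cBB'; case: MB MB' => [Bn B0] [B'n B'0]; apply: seriesP => i.
have [ilt|] := boolP (0 <= i <= n%:Z); last first.
  move=> ni; have [->|inS] := eqVneq i n.+1; first by rewrite Bn B'n.
  by rewrite B0 ?B'0//; lia.
have := congr1 (fun M : gl => M 0 (inord `|n%:Z - i|%N)) cBB'.
rewrite !mxE eqxx inordK; last by lia.
move/oppr_inj; rewrite (_ : _ - _ = i)//; lia.
Qed.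

End Rho.

(* Main.v *)
From HB Require Import structures.
From mathcomp Require Import all_boot all_order all_algebra.
From mathcomp Require Import complex.
From mathcomp Require Import all_classical all_reals all_analysis.
From mathcomp Require Import perm zify ring.
Require Import Defs.

Set Implicit Arguments.
Unset Strict Implicit.
Unset Printing Implicit Defensive.

Import Order.TTheory GRing.Theory Num.Theory.
Import numFieldNormedType.Exports.
Local Open Scope classical_set_scope.
Local Open Scope ring_scope.

(** For an invariant functional with gradient G at A, put
    k = h^-1(A G) - G A.  Invariance under L N_+ makes k upper triangular, and
    the bracket becomes <r_0 k_0, k2_0> + (<k, G2 A> - <G A, k2>) / 2, with k_0
    the diagonal part of k; both terms are gauge invariant, so A may be taken
    to be the companion matrix of B = D^n + u_1 D^(n-1) + ... + u_n.  There G is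
    determined by F = d phi(B) up to a strictly upper triangular matrix, which
    does not contribute, and the extension Ghat of F whose k vanishes outside
    the first row turns the bracket into the one on difference operators, with
      a = Theta, b = - h^n (Theta + 1/2), c = h^-n (Theta - 1/2), d = - Theta,
      Theta = (1/2) (1 + h^n) / (1 - h^n) + delta,
    where delta is the Fourier multiplier by which Delta acts on U_n.  Hence
    a + b - c - d = - delta (1 - h^n)^2 h^-n, which vanishes iff delta = 0.
    Conversely, a, b, c, d are tested on the functionals zint (f u_n) at
    D^n + 1, whose invariant extension is (-1)^n zint (f det A). *)

(** * Laurent series *)

#[global] Arguments zint : simpl never.

(** With h^-1(A G) = k + G A, the terms in r(G A) cancel because r commutes with the isometry h;
    this is where the short form of the bracket comes from. The Cayley transform is then evaluated
    through potentials: if the diagonal of k is a_i - h a_(i+1), with cyclic indices, any such a may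
    be used. For Ghat the diagonal of k has the single entry k_00, and solving around the cycle
    composes n shifts, which turns (1 + h tau) / (1 - h tau) into (1 + h^n) / (1 - h^n). A strictly
    upper triangular change of the gradient alters the Cayley term and the skew term by opposite
    amounts, and therefore does not contribute. The halves in b and c come from the cross terms of
    the skew term. On constants (1 - h^n)^2 vanishes and the defect says nothing; there delta is
    zero because Delta is skew. *)

Lemma fsum_ord (V : zmodType) (n : nat) (e : 'I_n -> int) (F : int -> V) :
  injective e -> (forall i, (forall l, i <> e l) -> F i = 0) ->
  \sum_(i \in [set: int]) F i = \sum_(l < n) F (e l).
Proof.
move=> einj F0.
rewrite (@fsum_supp _ [set` [seq e l | l : 'I_n]]); last first.
  by move=> i ni; apply: F0 => l il; apply: ni; rewrite /= il map_f ?mem_enum.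
rewrite -fsbig_seq; first by rewrite big_map big_enum.
by rewrite map_inj_uniq ?enum_uniq.
Qed.

(** The inner map t^2 has derivative 0 at 0, so differentiability of f at 0 is enough. This serves
    invariance along quadratic curves. *)
Lemma is_derive_comp_sqr (K : numFieldType) (f : K^o -> K^o) (a : K^o) :
  is_derive (0 : K^o) (1 : K^o) f a ->
  is_derive (0 : K^o) (1 : K^o) (fun t : K^o => f (t * t)) 0.
Proof.
move=> [df _].
have s0 : is_derive (0 : K^o) (1 : K^o) (fun t : K^o => t * t) 0.
  have := @is_deriveM K K^o id id 0 1 1 1 (is_derive_id _ _) (is_derive_id _ _).
  by rewrite !scale0r addr0.
have ds : differentiable (fun t : K^o => t * t : K^o) (0 : K^o).
  by apply/derivable1_diffP; case: s0.
have df' : differentiable f ((0 : K^o) * 0 : K^o).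
  by rewrite mul0r; apply/derivable1_diffP.
have dc : differentiable (f \o (fun t : K^o => t * t)) (0 : K^o).
  exact: differentiable_comp.
apply: DeriveDef; first by apply/derivable1_diffP.
have ds0 : 'd (fun t : K^o => t * t : K^o) (0 : K^o) 1 = 0.
  by rewrite -(deriveE (1 : K^o) ds); case: s0.
apply: (etrans (deriveE (1 : K^o) dc)).
apply: (etrans (congr1 (fun F => F (1 : K^o)) (diff_comp ds df'))).
rewrite /comp; apply: (etrans (congr1 _ ds0)); exact: linear0.
Qed.

Section Laurent.
Variable R : realType.
Local Notation C := R[i].
Local Notation L := (laurent R).
Implicit Types (a b : L) (c : C).

Lemma zintM a b : zint (a * b) = \sum_(i \in [set: int]) (a i * b (- i) : C).
Proof. by apply: eq_fsbigr => i _; rewrite sub0r. Qed.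

Lemma zintZ c a : zint (laurentC c * a) = c * zint a.
Proof. exact: laurentMCr. Qed.

Lemma laurentCD : {morph @laurentC R : c d / c + d}.
Proof. by move=> c d; apply: seriesP => i /=; case: ifP; rewrite ?addr0. Qed.

Lemma laurentCN : {morph @laurentC R : c / - c}.
Proof. by move=> c; apply: seriesP => i /=; case: ifP; rewrite ?oppr0. Qed.

Lemma laurentCM : {morph @laurentC R : c d / c * d}.
Proof.
by move=> c d; apply: seriesP => i; rewrite laurentMCr /=; case: ifP; rewrite ?mulr0.
Qed.

Lemma laurentC0 : laurentC 0 = 0 :> L.
Proof. by apply: seriesP => i /=; rewrite if_same. Qed.

Lemma laurentZ c a : c *: a = laurentC c * a.
Proof. by apply: seriesP => i; rewrite laurentMCr. Qed.

Lemma dilC c d : dil c (laurentC d) = laurentC d :> L.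
Proof.
by apply: seriesP => i /=; case: eqP => [->|_]; rewrite ?mulr0 ?expr0z ?mul1r.
Qed.

Lemma dilCM c d a : c != 0 -> dil c (laurentC d * a) = laurentC d * dil c a.
Proof. by move=> c0; rewrite dilM// dilC. Qed.

Lemma dil_one a : dil 1 a = a.
Proof. by apply: seriesP => i /=; rewrite exp1rz mul1r. Qed.

(** Nondegeneracy of the pairing: testing against z^(-i) reads off the coefficient at z^i. *)
Lemma zint_eq0 a : (forall b, zint (a * b) = 0) -> a = 0.
Proof.
move=> a0; apply: seriesP => i.
by have := a0 (monomial (1 : C^o) (- i)); rewrite zintM_monomial opprK.
Qed.

Fact mult_bounded (th : int -> C) a :
  exists N : int, forall i, N < i -> (th i * a i : C^o) = 0.
Proof. by have [N aN] := coefs_bounded a; exists N => i /aN ->; rewrite mulr0. Qed.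

(** The Fourier multiplier z^i -> th i z^i. Series bounded above in degree admit any sequence [th];
    h^n is the case th i = q^(n i), so functions of h^n make sense coefficientwise. *)
Definition mult (th : int -> C) a : L := @Series C^o _ (mult_bounded th a).

Fact mult_is_linear th : linear (mult th).
Proof.
move=> c a b; apply: seriesP => i /=; rewrite /GRing.scale /=; ring.
Qed.
HB.instance Definition _ th :=
  GRing.isLinear.Build C L L *:%R (mult th) (mult_is_linear th).

(** The integral pairs degree i with degree -i, so transposition reverses [th]; odd multipliers are
    skew. *)
Lemma mult_adj th a b : zint (mult th a * b) = zint (a * mult (fun k => th (- k)) b).
Proof. by rewrite !zintM; apply: eq_fsbigr => i _ /=; rewrite opprK; ring. Qed.

End Laurent.

(** * Gradients of invariant functionals *)

Section Pairing.
Variables (R : realType) (n : nat).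
Local Notation C := R[i].
Local Notation gl := 'M[laurent R]_n.
Implicit Types (A B D S T : gl) (a : laurent R) (c : C).

Lemma pairingC A B : pairing A B = pairing B A.
Proof. by rewrite /pairing mxtrace_mulC. Qed.

Lemma pairingDl A A' B : pairing (A + A') B = pairing A B + pairing A' B.
Proof. by rewrite /pairing mulmxDl raddfD. Qed.

Lemma pairingNl A B : pairing (- A) B = - pairing A B.
Proof. by rewrite /pairing mulNmx raddfN. Qed.

Lemma pairingBl A A' B : pairing (A - A') B = pairing A B - pairing A' B.
Proof. by rewrite pairingDl pairingNl. Qed.

Lemma pairingZl c A B : pairing (laurentC c *: A) B = c * pairing A B.
Proof. by rewrite /pairing -scalemxAl mxtraceZ zintZ. Qed.

Lemma pairingDr A B B' : pairing A (B + B') = pairing A B + pairing A B'.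
Proof. by rewrite !(pairingC A) pairingDl. Qed.

Lemma pairingBr A B B' : pairing A (B - B') = pairing A B - pairing A B'.
Proof. by rewrite !(pairingC A) pairingBl. Qed.

Lemma pairingE A B : pairing A B = \sum_i \sum_j zint (A i j * B j i).
Proof.
rewrite /pairing /mxtrace zint_sum; apply: eq_bigr => i _.
by rewrite mxE zint_sum.
Qed.

Lemma pairing_delta A i j a : pairing A (a *: delta_mx i j) = zint (A j i * a).
Proof.
rewrite pairingE (bigD1 j)//= [X in _ + X]big1 ?addr0 => [|l /negPf lj].
  rewrite (bigD1 i)//= !mxE !eqxx mulr1 big1 ?addr0// => k /negPf ki.
  by rewrite !mxE ki !mulr0.
by rewrite big1// => k _; rewrite !mxE lj andbF !mulr0.
Qed.

Lemma pairing_mulA A B D : pairing (A *m B) D = pairing A (B *m D).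
Proof. by rewrite /pairing mulmxA. Qed.

Lemma pairing_conj A B S T : T *m S = 1%:M ->
  pairing (S *m A *m T) (S *m B *m T) = pairing A B.
Proof.
move=> TS; rewrite /pairing !mulmxA -[_ *m T *m S]mulmxA TS mulmx1.
by rewrite mxtrace_mulC !mulmxA TS mul1mx.
Qed.

Lemma shiftB c A B : shift c (A - B) = shift c A - shift c B.
Proof. by apply/matrixP => i j; rewrite !mxE raddfB. Qed.

Lemma shiftD c A B : shift c (A + B) = shift c A + shift c B.
Proof. by apply/matrixP => i j; rewrite !mxE raddfD. Qed.

Lemma shiftZ c d A : c != 0 -> shift c (laurentC d *: A) = laurentC d *: shift c A.
Proof. by move=> c0; apply/matrixP => i j; rewrite !mxE dilCM. Qed.

Lemma shiftM c A B : c != 0 -> shift c (A *m B) = shift c A *m shift c B.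
Proof.
move=> c0; apply/matrixP => i j; rewrite !mxE raddf_sum /=.
by apply: eq_bigr => k _; rewrite dilM// !mxE.
Qed.

Lemma shift1 c : shift c 1%:M = 1%:M :> gl.
Proof.
by apply/matrixP => i j; rewrite !mxE; case: eqP => _; rewrite ?dil1 ?raddf0.
Qed.

Lemma shiftK c A : c != 0 -> shift c^-1 (shift c A) = A.
Proof.
by move=> c0; apply/matrixP => i j; rewrite !mxE dil_comp mulVf// dil_one.
Qed.

Lemma shiftVK c A : c != 0 -> shift c (shift c^-1 A) = A.
Proof. by move=> c0; apply/matrixP => i j; rewrite !mxE dilK. Qed.

Lemma pairing_shift c A B : c != 0 -> pairing (shift c A) (shift c B) = pairing A B.
Proof.
move=> c0; rewrite !pairingE; apply: eq_bigr => i _; apply: eq_bigr => j _.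
by rewrite !mxE -dilM// zint_dil.
Qed.

Lemma pairing_shiftl c A B : c != 0 -> pairing (shift c^-1 A) B = pairing A (shift c B).
Proof. by move=> c0; rewrite -[LHS](pairing_shift _ _ c0) shiftVK. Qed.

End Pairing.

Section Gradient.
Variables (R : realType) (q : R[i]) (n : nat).
Local Notation C := R[i].
Local Notation L := (laurent R).
Local Notation gl := 'M[laurent R]_n.
Hypothesis q0 : q != 0.
Implicit Types (A G S X : gl).

Let LN (S : gl) : LNplus S -> S \in unitmx.
Proof. by case: n S => [S _|m S]; [rewrite unitmxE det_mx00 unitr1|exact: LNplus_unit]. Qed.

Definition grad_diff A G : gl := shift q^-1 (A *m G) - G *m A.

(** For fixed S the action is linear in A, so it carries lines to lines; [X0] is the direction
    carried to X, and transposing this map moves the gradient. *)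
Lemma grad_gauge (phi : gl -> C) A G S : gauge_invariant q phi -> LNplus S ->
  is_grad_gl phi A G ->
  is_grad_gl phi (gauge q S A) (S *m G *m shift q (invmx S)).
Proof.
move=> phiI SN gG X; have uS := LN SN.
have hS : shift q S *m shift q (invmx S) = 1%:M by rewrite -shiftM// mulmxV// shift1.
pose X0 := shift q (invmx S) *m X *m S.
have -> : pairing (S *m G *m shift q (invmx S)) X = pairing G X0.
  by rewrite /pairing /X0 -!mulmxA mxtrace_mulC -!mulmxA.
rewrite (_ : (fun t : C^o => _) = (fun t : C^o => phi (A + laurentC t *: X0)))//.
apply/funext => t; rewrite -(phiI S (A + _))//; congr phi.
rewrite /gauge mulmxDr mulmxDl -scalemxAr -scalemxAl; congr (_ + _ *: _).
by rewrite /X0 !mulmxA hS mul1mx mulmxK.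
Qed.

(** The h^-1 in [grad_diff] undoes the twist of the action: the result is conjugated by S itself,
    and the pairing is invariant under such a conjugation. *)
Lemma grad_diff_gauge A G S : LNplus S ->
  grad_diff (gauge q S A) (S *m G *m shift q (invmx S)) =
  S *m grad_diff A G *m invmx S.
Proof.
move=> SN; have uS := LN SN.
have SiS := mulVmx uS.
have hS : shift q (invmx S) *m shift q S = 1%:M by rewrite -shiftM// mulVmx// shift1.
rewrite /grad_diff mulmxBr mulmxBl /gauge; congr (_ - _); last first.
  by rewrite !mulmxA -[_ *m _ *m shift q S]mulmxA hS mulmx1.
rewrite -[RHS](shiftK _ q0); congr shift.
rewrite (shiftM _ _ q0) (shiftM _ _ q0) (shiftVK _ q0).
by rewrite -!mulmxA (mulmxA (invmx S)) SiS mul1mx.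
Qed.

(* The elementary curve [S_t = 1 - t a E_ij] turns the line [A + t X] into *)
(* [A + t^2 Q]: invariance along it needs only the chain rule in one        *)
(* variable, although [phi] is merely assumed differentiable along lines.   *)
Lemma grad_diff_upper (phi : gl -> C) A G : gauge_invariant q phi ->
  is_grad_gl phi A G -> forall i j : 'I_n, (j < i)%N -> grad_diff A G i j = 0.
Proof.
move=> phiI gG j i ij; apply: zint_eq0 => a.
pose xi : gl := a *: delta_mx i j.
pose hxi : gl := dil q a *: delta_mx i j.
have hxiE : shift q xi = hxi.
  apply/matrixP => k l; rewrite !mxE; case: (_ && _); rewrite ?mulr1 ?mulr0//.
  by rewrite raddf0.
have dd (b c : L) : (b *: delta_mx i j : gl) *m (c *: delta_mx i j) = 0.
  rewrite -scalemxAl -scalemxAr mul_delta_mx_0 ?scaler0//.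
  by rewrite -val_eqE /= gtn_eqF.
(* [X] and [Q] are chosen so that (1 - t hxi)(A + t X) = (A + t^2 Q)(1 - t xi) holds exactly; the
   leftover terms contain a product of two multiples of E_ij, which vanishes as i < j. *)
pose X := hxi *m A - A *m xi.
pose Q := hxi *m A *m xi.
have X0 : pairing G X = 0.
  have : is_derive (0 : C^o) (1 : C^o) (fun t : C^o => phi (A + laurentC t *: X) : C^o) 0.
    rewrite (_ : (fun t : C^o => _) = (fun t : C^o => phi (A + laurentC (t * t) *: Q))).
      exact: (is_derive_comp_sqr (f := fun t : C^o => phi (A + laurentC t *: Q) : C^o)).
    apply/funext => t; pose S : gl := 1%:M - laurentC t *: xi.
    have SN : LNplus S.
      move=> k l lk; rewrite !mxE; case: (altP (k =P i)) => [ki|]; last first.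
        by rewrite !mulr0 subr0.
      case: (altP (l =P j)) => [lj|]; last by rewrite !mulr0 subr0.
      by move: lk; rewrite ki lj leqNgt ij.
    rewrite -(phiI S (A + laurentC t *: X))//; congr phi.
    apply: (can_inj (mulmxK (LN SN))); rewrite /gauge mulmxKV ?LN//.
    have -> : shift q S = 1%:M - laurentC t *: hxi.
      by rewrite /S shiftB shift1 (shiftZ _ _ q0) hxiE.
    set c := laurentC t; rewrite laurentCM -/c.
    have -> : (A + (c * c) *: Q) *m S = A + (c * c) *: Q - c *: (A *m xi).
      rewrite /S mulmxBr mulmx1 -scalemxAr mulmxDl -scalemxAl /Q.
      by rewrite -[hxi *m A *m xi *m xi]mulmxA dd mulmx0 scaler0 addr0.
    rewrite mulmxBl mul1mx -scalemxAl mulmxDr -scalemxAr /X mulmxBr.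
    rewrite [hxi *m (hxi *m A)]mulmxA dd mul0mx sub0r scalerN.
    rewrite [hxi *m (A *m xi)]mulmxA -/Q scalerBr scalerBr scalerA.
    move: (c *: (hxi *m A)) (c *: (A *m xi)) ((c * c) *: Q) => X1 X2 X3.
    rewrite -addrA opprB [X1 - X2]addrC [X3 - X1]addrC -addrA addNKr.
    by rewrite [- X2 + X3]addrC addrA.
  by case=> _ <-; case: (gG X) => _ ->.
rewrite -X0 -(pairing_delta _ i j) /grad_diff pairingBl pairing_shiftl//.
rewrite -/xi hxiE pairingBr (pairing_mulA G A); congr (_ - _).
by rewrite /pairing -mulmxA mxtrace_mulC mulmxA.
Qed.

End Gradient.

(** * The r-matrix *)

Section RMatrix.
Variables (R : realType) (q : R[i]) (n : nat).
Local Notation C := R[i].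
Local Notation L := (laurent R).
Local Notation gl := 'M[laurent R]_n.
Hypotheses (n_gt0 : (0 < n)%N) (q_gt0 : 0 < `|q|) (q_lt1 : `|q| < 1).
Implicit Types (A B : gl) (f : L).

Let q0 : q != 0. Proof. by rewrite -normr_gt0. Qed.
Let qX i : q ^+ i != 0. Proof. exact: expf_neq0. Qed.
Let n0 : n%:R != 0 :> C. Proof. by rewrite pnatr_eq0 -lt0n. Qed.

Local Notation E := (range (@proj_0' R n)).
Local Notation T A := (shift q (tau A)).
Local Notation s0 A := (proj_0' (proj_diag A)).

Lemma htauD A B : T (A + B) = T A + T B.
Proof.
apply/matrixP => i j; rewrite /tau !mxE.
by case: eqP => _; rewrite ?mulr0n ?raddf0 ?addr0// !mulr1n raddfD.
Qed.

Lemma htauN A : T (- A) = - T A.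
Proof.
apply/matrixP => i j; rewrite /tau !mxE.
by case: eqP => _; rewrite ?mulr0n ?raddf0 ?oppr0// !mulr1n raddfN.
Qed.

Lemma htau_shift A : T (shift q A) = shift q (T A).
Proof.
apply/matrixP => i j; rewrite /tau !mxE.
by case: eqP => _; rewrite ?mulr0n ?raddf0 ?mulr1n.
Qed.

Lemma rangeE_diff A B : E A -> E B -> E (A - B).
Proof.
move=> /(range_proj_0'P n_gt0)[d -> d0] /(range_proj_0'P n_gt0)[e -> e0].
apply/(range_proj_0'P n_gt0); exists (d - e); first by rewrite raddfB.
rewrite (eq_bigr (fun i => d 0 i 0 - e 0 i 0)) ?sumrB ?d0 ?e0 ?subr0//.
by move=> i _; rewrite !mxE.
Qed.

Lemma rangeE_shift A : E A -> E (shift q A).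
Proof.
move=> /(range_proj_0'P n_gt0)[d -> d0]; apply/(range_proj_0'P n_gt0).
exists (map_mx (dil q) d).
  by apply/matrixP => i j; rewrite !mxE; case: eqP; rewrite ?raddf0.
by rewrite -[RHS]d0; apply: eq_bigr => i _; rewrite mxE; exact: zint_dil.
Qed.

Lemma inv_1_htauP A : E A ->
  E (inv_1_htau q A) /\ inv_1_htau q A - T (inv_1_htau q A) = A.
Proof.
move=> /(htau_invertible n_gt0 q_lt1)[B [BP _]]; rewrite /inv_1_htau.
by case: xgetP => [X _ //|/(_ B)/(_ BP)].
Qed.

(** [inv_1_htau] is a choice; additivity and commutation with h are inherited from the uniqueness of
    the solution it selects. *)
Lemma inv_1_htau_eq A B : E A -> E B -> B - T B = A -> inv_1_htau q A = B.
Proof.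
move=> EA EB BA; have [X [_ Xu]] := htau_invertible n_gt0 q_lt1 EA.
by rewrite -(Xu _ (inv_1_htauP EA)); exact: Xu.
Qed.

Lemma cayleyB A B : E A -> E B -> cayley q (A - B) = cayley q A - cayley q B.
Proof.
move=> EA EB; have [EX XA] := inv_1_htauP EA; have [EY YB] := inv_1_htauP EB.
rewrite /cayley (@inv_1_htau_eq _ (inv_1_htau q A - inv_1_htau q B)).
- by rewrite htauD htauN addrACA opprD.
- exact: rangeE_diff.
- exact: rangeE_diff.
by rewrite htauD htauN -[in RHS]XA -[in RHS]YB opprD addrACA -opprD.
Qed.

Lemma cayley_shift A : E A -> cayley q (shift q A) = shift q (cayley q A).
Proof.
move=> EA; have [EX XA] := inv_1_htauP EA.
rewrite /cayley (@inv_1_htau_eq _ (shift q (inv_1_htau q A))).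
- by rewrite htau_shift shiftD.
- exact: rangeE_shift.
- exact: rangeE_shift.
by rewrite htau_shift -shiftB XA.
Qed.

Lemma proj_diagB A B : proj_diag (A - B) = proj_diag A - proj_diag B.
Proof.
by apply/matrixP => i j; rewrite !mxE; case: eqP; rewrite ?mulr0n ?subr0.
Qed.

Lemma proj_diag_shift A : proj_diag (shift q A) = shift q (proj_diag A).
Proof.
by apply/matrixP => i j; rewrite !mxE; case: eqP; rewrite ?mulr0n ?raddf0.
Qed.

Lemma proj_diagK A : proj_diag (proj_diag A) = proj_diag A.
Proof. by congr diag_mx; apply/rowP => i; rewrite !mxE eqxx. Qed.

Lemma proj_0'B A B : proj_0' (A - B) = proj_0' A - proj_0' B.
Proof.
have key : proj_00 (proj_diag A - proj_diag B) =
    proj_00 (proj_diag A) - proj_00 (proj_diag B).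
  have scB (c d : C) : (laurentC (c - d))%:M = (laurentC c)%:M - (laurentC d)%:M :> gl.
    by rewrite laurentCD laurentCN raddfB.
  rewrite !proj_00E// -scB -mulrBr -sumrB.
  congr (laurentC (_ * _))%:M; apply: eq_bigr => i _.
  by rewrite [in LHS]mxE [(- proj_diag B) i i]mxE.
rewrite /proj_0' proj_diagB key.
rewrite !opprB [proj_00 (proj_diag B) - _]addrC addrACA.
by rewrite [- proj_diag B + _]addrC.
Qed.

Lemma proj_0'_shift A : proj_0' (shift q A) = shift q (proj_0' A).
Proof.
rewrite /proj_0' proj_diag_shift !proj_00E// shiftB; congr (_ - _).
apply/matrixP => i j; rewrite !mxE; case: eqP => _; last by rewrite !mulr0n raddf0.
rewrite dilC; congr (laurentC (_ * _)); apply: eq_bigr => k _.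
by rewrite !mxE zint_dil.
Qed.

(** The potential a need not be the solution x selected by [inv_1_htau], but z = x - a is fixed by h
    tau. As h tau is an isometry, the contribution 2 <z, b - h tau b> of z is zero. *)
Lemma pairing_cayley A B (a b : 'I_n -> L) :
  (forall i, A i i = a i - dil q (a (ordS i))) ->
  (forall i, B i i = b i - dil q (b (ordS i))) ->
  pairing (cayley q (s0 A)) B =
  \sum_i zint ((a i + dil q (a (ordS i))) * (b i - dil q (b (ordS i)))).
Proof.
move=> Aa Bb.
have reS (F : 'I_n -> C) : \sum_i F (ordS i) = \sum_i F i.
  by rewrite [RHS](reindex (@ordS n))//; exact: onW_bij (ordS_bij n).
have [x [xE xA]] : exists x : 'rV[L]_n, inv_1_htau q (s0 A) = diag_mx x /\
    forall i, x 0 i - dil q (x 0 (ordS i)) = A i i.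
  have EA : E (s0 A) by exists (proj_diag A).
  have [/(range_proj_0'P n_gt0)[x xE _]] := inv_1_htauP EA.
  rewrite {}xE => xA; exists x; split=> // i.
  (* The trace of A integrates to zero, so P_0' removes nothing from its diagonal. *)
  have A0 : \sum_i zint (proj_diag A i i) = 0.
    rewrite (eq_bigr (fun i => zint (a i) - zint (a (ordS i)))); last first.
      by move=> k _; rewrite !mxE eqxx mulr1n Aa -(zint_dil q (a (ordS k))).
    by rewrite sumrB (reS (fun i => zint (a i))) subrr.
  have := congr1 (fun M : gl => M i i) xA.
  rewrite htau_diag /proj_0' proj_diagK proj_00E// A0 mulr0 laurentC0 raddf0.
  by rewrite subr0 !mxE eqxx !mulr1n.
rewrite pairingC /cayley xE.
rewrite (_ : _ + _ = diag_mx (\row_i (x 0 i + dil q (x 0 (ordS i))))); last first.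
  apply/matrixP => i j; rewrite !mxE; case: eqP => _.
    by rewrite eqxx !mulr1n.
  by rewrite !mulr0n raddf0 addr0.
rewrite pairing_diag; apply/eqP; rewrite -subr_eq0 -sumrB; apply/eqP.
pose z i := x 0 i - a i.
have zT i : dil q (z (ordS i)) = z i.
  apply/eqP; rewrite eq_sym -subr_eq0 /z raddfB /=; apply/eqP.
  transitivity (x 0 i - dil q (x 0 (ordS i)) - (a i - dil q (a (ordS i)))).
    by ring.
  by rewrite xA Aa subrr.
have e i : zint (B i i * (\row_j (x 0 j + dil q (x 0 (ordS j)))) 0 i) -
    zint ((a i + dil q (a (ordS i))) * (b i - dil q (b (ordS i)))) =
    (zint (z i * b i) - zint (z (ordS i) * b (ordS i))) *+ 2.
  rewrite -(zint_dil q (z (ordS i) * _)) dilM// zT mxE Bb mulr2n.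
  rewrite /zint -!laurentN -!laurentD; congr ((_ : L) 0).
  have -> : x 0 i = z i + a i by rewrite subrK.
  have -> : x 0 (ordS i) = z (ordS i) + a (ordS i) by rewrite subrK.
  by rewrite raddfD /= zT; ring.
under eq_bigr do rewrite e.
by rewrite sumrMnl sumrB (reS (fun i => zint (z i * b i))) subrr mul0rn.
Qed.

Definition Ud f : gl := diag_mx (\row_i dil (q ^- i) f).

Lemma Ud_Uspace f : Uspace q (Ud f). Proof. by exists f. Qed.

Lemma pairing_Ud f A : pairing (Ud f) A = zint (f * \sum_(i < n) dil (q ^+ i) (A i i)).
Proof.
rewrite pairingC pairing_diag mulr_sumr zint_sum; apply: eq_bigr => i _.
by rewrite mxE zintM_dil// mulrC.
Qed.

Lemma pairing_UdUd f g : pairing (Ud f) (Ud g) = n%:R * zint (f * g).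
Proof.
rewrite pairing_Ud (eq_bigr (fun=> g)); last first.
  by move=> i _; rewrite !mxE eqxx mulr1n dil_comp mulfV// dil_one.
by rewrite sumr_const card_ord mulrnAr /zint laurentMn.
Qed.

Lemma dil_monomial (k : int) : dil q (monomial (1 : C^o) k) =
  laurentC (q ^ k) * monomial (1 : C^o) k :> L.
Proof.
by apply: seriesP => i; rewrite laurentMCr /=; case: eqP => [->|]; rewrite ?mulr0.
Qed.

Lemma UdZ (c : C) f : Ud (laurentC c * f) = laurentC c *: Ud f.
Proof.
apply/matrixP => i j; rewrite !mxE; case: eqP => _; last by rewrite !mulr0n mulr0.
by rewrite !mulr1n dilCM// invr_neq0.
Qed.

Lemma shift_Ud f : shift q (Ud f) = Ud (dil q f).
Proof.
apply/matrixP => i j; rewrite !mxE; case: eqP => _; last by rewrite !mulr0n raddf0.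
by rewrite !mulr1n !dil_comp mulrC.
Qed.

Lemma q_expz_inj (i j : int) : q ^ i = q ^ j -> i = j.
Proof.
move=> qij; apply/eqP; rewrite -subr_eq0; apply/negPn/negP => ij0.
have := qn_neq1 n_gt0 q_lt1 ij0.
by rewrite expfzDr// qij -expfzDr// subrr expr0z expr1n eqxx.
Qed.

End RMatrix.

(** * The bracket of invariant functionals in terms of k *)

Section Bracket.
Variables (R : realType) (q : R[i]) (n : nat).
Local Notation C := R[i].
Local Notation L := (laurent R).
Local Notation gl := 'M[laurent R]_n.
Variable Delta : gl -> gl.
Hypotheses (n_gt0 : (0 < n)%N) (q_gt0 : 0 < `|q|) (q_lt1 : `|q| < 1).
Hypotheses (DeltaU : operator_in_U q Delta) (Delta_skew : skew_in_U q Delta).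
Hypothesis (Delta_shift : commutes_with_shift_in_U q Delta).
Implicit Types (A B : gl) (f : L).

Let q0 : q != 0. Proof. by rewrite -normr_gt0. Qed.
Let n0 : n%:R != 0 :> C. Proof. by rewrite pnatr_eq0 -lt0n. Qed.

Local Notation Ud := (@Ud R q n).

(* [Delta] commutes with the shift, which has distinct eigenvalues on the *)
(* monomials, and skewness extends the diagonal form to infinite series.  *)
Lemma Delta_mult : exists2 delta : int -> C, (forall k, delta (- k) = - delta k) &
  forall f, Delta (Ud f) = Ud (mult delta f).
Proof.
pose mon (k : int) : L := monomial (1 : C^o) k.
have UD f : Uspace q (Ud f) by exact: Ud_Uspace.
have DU f : exists g, Delta (Ud f) = Ud g.
  by have [+ _] := DeltaU => /(_ _ (UD f))[g _ <-]; exists g.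
have D0 : Delta 0 = 0.
  have U0 : Uspace q (0 : gl).
    by exists 0 => //; apply/matrixP => i j; rewrite !mxE raddf0 mul0rn.
  have [_ lin] := DeltaU; have := lin (- 1) 0 0 U0 U0; rewrite scaler0 addr0.
  by rewrite laurentCN scaleNr scale1r addNr.
have DZ c f : Delta (laurentC c *: Ud f) = laurentC c *: Delta (Ud f).
  have U0 : Uspace q (0 : gl).
    by exists 0 => //; apply/matrixP => i j; rewrite !mxE raddf0 mul0rn.
  by have [_ lin] := DeltaU; have := lin c (Ud f) 0 (UD f) U0; rewrite !addr0 D0 addr0.
have UdI : injective Ud.
  move=> f g fg; apply/eqP; rewrite -subr_eq0; apply/eqP/zint_eq0 => b.
  rewrite mulrBl; apply: (mulfI n0); rewrite mulr0 -[zint _]/(zint _ - zint _).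
  by rewrite mulrBr -!(pairing_UdUd n q_gt0) fg subrr.
have [d dE] : exists d : int -> C, forall k, Delta (Ud (mon k)) = Ud (laurentC (d k) * mon k).
  have /choice [g gE] : forall k, exists g, Delta (Ud (mon k)) = Ud g by move=> k; exact: DU.
  exists (fun k => g k k) => k; rewrite gE; apply: (congr1 Ud).
  apply: seriesP => i; rewrite laurentMCr /=.
  case: eqP => [->|ik]; rewrite ?mulr1 ?mulr0//.
  have := Delta_shift (UD (mon k)); rewrite shift_Ud// dil_monomial UdZ//.
  rewrite DZ gE shift_Ud// -UdZ// => /UdI /(congr1 (fun a : L => a i)).
  rewrite laurentMCr /= => /eqP; rewrite -subr_eq0 -mulrBl mulf_eq0.
  case/orP => [|/eqP//]; rewrite subr_eq0 => /eqP /(q_expz_inj n_gt0 q_gt0 q_lt1) ki.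
  by case: ik.
have DE f k : forall g, Delta (Ud f) = Ud g -> g k = - d (- k) * f k.
  move=> g gE; have := Delta_skew (UD f) (UD (mon (- k))).
  rewrite gE dE !pairing_UdUd// mulrCA zintZ zintM_monomial zintM_monomial opprK.
  by rewrite -mulrN => /(mulfI n0) ->; rewrite mulNr.
have dN k : d (- k) = - d k.
  have := DE (mon k) k _ (dE k); rewrite laurentMCr /= eqxx !mulr1 => ->.
  by rewrite opprK.
exists d => // f; have [g gE] := DU f; rewrite gE; apply: (congr1 Ud).
by apply: seriesP => k; rewrite (DE _ _ _ gE) dN opprK.
Qed.

Variable delta : int -> C.
Hypothesis DeltaE : forall f, Delta (Ud f) = Ud (mult delta f).

Definition kappa A : L := \sum_(i < n) dil (q ^+ i) (A i i).

(** The orthogonal projection onto U_n is [Ud] of kappa / n; the factor n in front of Delta cancels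
    this denominator. *)
Lemma Delta_projE A :
  Delta (orth_proj (@Uspace R q n) (proj_diag A)) *+ n = Ud (mult delta (kappa A)).
Proof.
rewrite orth_proj_UE// -/(Ud _) DeltaE.
have -> : \sum_(j < n) dil (q ^+ j) (proj_diag A j j) = kappa A.
  by apply: eq_bigr => i _; rewrite !mxE eqxx.
rewrite -laurentZ linearZ /= laurentZ UdZ//.
apply/matrixP => i j; rewrite mulmxnE mxE -mulrnAl.
suff -> : laurentC n%:R^-1 *+ n = 1 :> L by rewrite mul1r.
by apply: seriesP => k; rewrite laurentMn /=; case: eqP; rewrite ?mulr0// mulfV.
Qed.

Lemma kappaB A B : kappa (A - B) = kappa A - kappa B.
Proof. by rewrite /kappa -sumrB; apply: eq_bigr => i _; rewrite !mxE raddfB. Qed.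

Lemma kappa_shift A : kappa (shift q A) = dil q (kappa A).
Proof.
rewrite /kappa raddf_sum; apply: eq_bigr => i _.
by rewrite !mxE /= !dil_comp mulrC.
Qed.

Let EA A : range (@proj_0' R n) (proj_0' A). Proof. by exists A. Qed.

Lemma rmatE A : rmat q Delta A = half R *: (proj_upper A - proj_lower A)
  + (half R *: cayley q (proj_0' (proj_diag A)) + Ud (mult delta (kappa A))).
Proof. by congr (_ + (_ + _)); exact: Delta_projE. Qed.

Lemma rmatB A B : rmat q Delta (A - B) = rmat q Delta A - rmat q Delta B.
Proof.
rewrite !rmatE proj_diagB (proj_0'B n_gt0).
rewrite (cayleyB n_gt0 q_lt1 (EA _) (EA _)) kappaB.
have -> : proj_upper (A - B) - proj_lower (A - B) =
    proj_upper A - proj_lower A - (proj_upper B - proj_lower B).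
  apply/matrixP => i j; rewrite !mxE.
  by case: ltngtP => _; rewrite !(subr0, oppr0, sub0r, opprB, opprK) // addrC.
have -> : Ud (mult delta (kappa A - kappa B)) =
    Ud (mult delta (kappa A)) - Ud (mult delta (kappa B)).
  apply/matrixP => i j; rewrite !mxE; case: eqP; rewrite ?mulr0n ?subr0// !mulr1n.
  by rewrite !raddfB.
have e (a b c d u v : gl) : a - b + (c - d + (u - v)) = a + (c + u) - (b + (d + v)).
  by rewrite [c - d + _]addrACA -opprD addrACA -opprD.
by rewrite [half R *: (_ - _ - _)]scalerBr [half R *: (cayley _ _ - _)]scalerBr e.
Qed.

Lemma rmat_shift A : rmat q Delta (shift q A) = shift q (rmat q Delta A).
Proof.
rewrite !rmatE proj_diag_shift (proj_0'_shift q n_gt0).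
rewrite (cayley_shift n_gt0 q_lt1 (EA _)) kappa_shift.
rewrite [RHS]shiftD [X in _ = _ + X]shiftD !(shiftZ _ _ q0).
congr (_ *: _ + (_ + _)).
  by apply/matrixP => i j; rewrite !mxE; case: ltngtP; rewrite ?subr0 ?sub0r ?raddfN ?raddf0.
rewrite shift_Ud//; congr (Ud _); apply: seriesP => k /=; ring.
Qed.

Definition upper A := forall i j : 'I_n, (j < i)%N -> A i j = 0.

Lemma pairing_upper A B : upper A -> upper B ->
  pairing A B = \sum_i zint (A i i * B i i).
Proof.
move=> uA uB; rewrite pairingE; apply: eq_bigr => i _.
rewrite (bigD1 i)//= big1 ?addr0// => j ji.
have [ij|ij|/val_inj ij] := ltngtP i j; last by rewrite ij eqxx in ji.
  by rewrite uB// mulr0.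
by rewrite uA// mul0r.
Qed.

Let pairing_strict (k k2 : gl) : upper k -> upper k2 ->
  pairing (proj_upper k - proj_lower k) k2 = 0.
Proof.
move=> uk uk2; rewrite pairing_upper//.
  by rewrite big1// => i _; rewrite !mxE ltnn subr0 mul0r.
by move=> i j ji; rewrite !mxE ji uk// ltnNge ltnW// subr0.
Qed.

(** With r1 = r k and r2 = r m, the terms r2 cancel, and the corrections +1/2 and -1/2 in r_+ and
    r_- leave the skew term. *)
Let pairing_rmat (r1 r2 k m k2 m2 : gl) :
  pairing (r1 + r2 - (r2 + half R *: m)) (k2 + m2)
  - pairing (r1 + r2 - half R *: (k + m) - r2) m2
  = pairing r1 k2 + 2^-1 * (pairing k m2 - pairing m k2).
Proof.
have -> : r1 + r2 - (r2 + half R *: m) = r1 - half R *: m.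
  by rewrite opprD addrA addrK.
have -> : r1 + r2 - half R *: (k + m) - r2 = r1 - half R *: k - half R *: m.
  by rewrite addrAC addrK scalerDr opprD addrA.
by rewrite pairingDr !pairingBl !pairingZl; ring.
Qed.

Definition grad_form (A G G2 : gl) : C :=
  2^-1 * pairing (cayley q (proj_0' (proj_diag (grad_diff q A G)))) (grad_diff q A G2)
  + zint (mult delta (kappa (grad_diff q A G)) * kappa (grad_diff q A G2))
  + 2^-1 * (pairing (grad_diff q A G) (G2 *m A) - pairing (G *m A) (grad_diff q A G2)).

(** Both A G and A G2 are written as h(k + m), m being G A resp. G2 A. As r commutes with h and h
    preserves the pairing, all shifts disappear. Upper triangular matrices pair along the diagonal
    only, so the part P_+ - P_- of r drops out. *)
Lemma bracket_glE phi psi A :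
  upper (grad_diff q A (grad_gl phi A)) -> upper (grad_diff q A (grad_gl psi A)) ->
  bracket_gl q Delta phi psi A = grad_form A (grad_gl phi A) (grad_gl psi A).
Proof.
rewrite /grad_form /bracket_gl /rmat_plus /rmat_minus.
set G := grad_gl phi A; set G2 := grad_gl psi A.
set k := grad_diff q A G; set k2 := grad_diff q A G2 => uk uk2.
set m' := G *m A; set m2' := G2 *m A.
have mE : shift q^-1 (A *m G) = k + m' by rewrite /k /grad_diff subrK.
have m2E : A *m G2 = shift q (k2 + m2').
  by rewrite /k2 /grad_diff subrK shiftVK.
have m1E : A *m G = shift q (k + m') by rewrite -mE shiftVK.
rewrite mE m2E m1E rmat_shift -shiftB pairing_shift//.
have rD : rmat q Delta (k + m') = rmat q Delta k + rmat q Delta m'.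
  by apply/eqP; rewrite -subr_eq -rmatB addrK.
have -> : pairing (rmat q Delta (k + m') - (rmat q Delta m' + half R *: m')) (k2 + m2')
  - pairing (rmat q Delta (k + m') - half R *: (k + m') - rmat q Delta m') m2'
  = pairing (rmat q Delta k) k2 + 2^-1 * (pairing k m2' - pairing m' k2).
  by rewrite rD; exact: pairing_rmat.
congr (_ + _); rewrite rmatE pairingDl pairingZl.
rewrite pairing_strict//.
by rewrite mulr0 add0r pairingDl pairingZl pairing_Ud.
Qed.

End Bracket.

(** * Gauge invariance of the Cayley, Delta and skew terms *)

Section GaugeInvariance.
Variables (R : realType) (q : R[i]) (n : nat).
Local Notation C := R[i].
Local Notation L := (laurent R).
Local Notation gl := 'M[laurent R]_n.
Hypotheses (n_gt0 : (0 < n)%N) (q_gt0 : 0 < `|q|) (q_lt1 : `|q| < 1).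
Variable delta : int -> C.
Implicit Types (A G K S : gl) (a b : 'I_n -> L).

Let q0 : q != 0. Proof. by rewrite -normr_gt0. Qed.

Definition potential a K := forall i, K i i = a i - dil q (a (ordS i)).

Definition omega A G G2 : C :=
  pairing (grad_diff q A G) (G2 *m A) - pairing (G *m A) (grad_diff q A G2).

Lemma grad_formE A G G2 a b : potential a (grad_diff q A G) ->
  potential b (grad_diff q A G2) ->
  grad_form q delta A G G2 =
  2^-1 * (\sum_i zint ((a i + dil q (a (ordS i))) * grad_diff q A G2 i i)
          + omega A G G2)
  + zint (mult delta (kappa q (grad_diff q A G)) * kappa q (grad_diff q A G2)).
Proof.
move=> aG bG2; rewrite /grad_form (pairing_cayley n_gt0 q_gt0 q_lt1 aG bG2).
rewrite -/(omega A G G2) [X in _ = X + _]mulrDr [RHS]addrAC; congr (_ * _ + _ + _).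
by apply: eq_bigr => i _; rewrite bG2.
Qed.

(** Compare the diagonals of K' S = S K, where all factors are upper triangular and S is
    unipotent. *)
Lemma diag_conj S K : LNplus S -> upper K -> upper (S *m K *m invmx S) ->
  S \in unitmx -> forall i, (S *m K *m invmx S) i i = K i i.
Proof.
move=> SN uK uK' uS i; have := mulmxKV uS (S *m K); move: uK'.
move: (S *m K *m invmx S) => K' uK' /(congr1 (fun M : gl => M i i)).
rewrite [LHS]mxE [RHS]mxE.
rewrite (bigD1 i)//= big1 ?addr0 => [|j ji]; last first.
  have [ji'|ij|/val_inj jE] := ltngtP j i; last by rewrite jE eqxx in ji.
    by rewrite uK'// mul0r.
  by rewrite SN 1?ltnW// (negPf ji) mulr0.
rewrite SN// eqxx mulr1 => ->.
rewrite (bigD1 i)//= big1 ?addr0 => [|j ji]; last first.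
  have [ji'|ij|/val_inj jE] := ltngtP j i; last by rewrite jE eqxx in ji.
    by rewrite SN 1?ltnW// eq_sym (negPf ji) mul0r.
  by rewrite uK// mulr0.
by rewrite SN// eqxx mul1r.
Qed.

Lemma omega_gauge A G G2 S : LNplus S -> S \in unitmx ->
  omega (gauge q S A) (S *m G *m shift q (invmx S)) (S *m G2 *m shift q (invmx S))
  = omega A G G2.
Proof.
move=> SN uS; have SiS := mulVmx uS.
have hS : shift q (invmx S) *m shift q S = 1%:M by rewrite -shiftM// SiS shift1.
have mE (X : gl) : S *m X *m shift q (invmx S) *m gauge q S A = S *m (X *m A) *m invmx S.
  rewrite /gauge -!mulmxA (mulmxA (shift q (invmx S))) hS mul1mx.
  by rewrite !mulmxA.
rewrite /omega (mE G) (mE G2) (grad_diff_gauge q0 A G SN) (grad_diff_gauge q0 A G2 SN).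
by congr (_ - _); exact: pairing_conj.
Qed.

Lemma grad_form_congr A G G2 A' G' G2' a b :
  potential a (grad_diff q A' G') -> potential b (grad_diff q A' G2') ->
  (forall i, grad_diff q A' G' i i = grad_diff q A G i i) ->
  (forall i, grad_diff q A' G2' i i = grad_diff q A G2 i i) ->
  omega A' G' G2' = omega A G G2 ->
  grad_form q delta A G G2 = grad_form q delta A' G' G2'.
Proof.
move=> pa pb kE kE2 oE.
have pa' : potential a (grad_diff q A G) by move=> i; rewrite -kE pa.
have pb' : potential b (grad_diff q A G2) by move=> i; rewrite -kE2 pb.
have kkE : kappa q (grad_diff q A' G') = kappa q (grad_diff q A G).
  by apply: eq_bigr => i _; rewrite kE.
have kkE2 : kappa q (grad_diff q A' G2') = kappa q (grad_diff q A G2).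
  by apply: eq_bigr => i _; rewrite kE2.
rewrite (grad_formE pa pb) (grad_formE pa' pb') oE kkE kkE2.
by congr (_ * (_ + _) + _); apply: eq_bigr => i _; rewrite kE2.
Qed.

Lemma omegaC A G G2 : omega A G2 G = - omega A G G2.
Proof. by rewrite /omega opprB ![pairing (grad_diff _ _ _) _]pairingC. Qed.

(* The two sides differ by [tr (A G A G2) - tr (G A G2 A) = 0]. *)
Lemma omegaE A G G2 : omega A G G2 =
  - (pairing (shift q^-1 (A *m G)) (grad_diff q A G2)
     + pairing (G *m A) (grad_diff q A G2)).
Proof.
have e : pairing (shift q^-1 (A *m G)) (shift q^-1 (A *m G2)) =
    pairing (G *m A) (G2 *m A).
  rewrite pairing_shiftl// shiftVK// /pairing -!mulmxA mxtrace_mulC.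
  by rewrite -!mulmxA.
rewrite /omega /grad_diff !pairingBr !pairingBl e.
by ring.
Qed.

Lemma grad_diffD A G G' : grad_diff q A (G + G') = grad_diff q A G + grad_diff q A G'.
Proof. by rewrite /grad_diff mulmxDr mulmxDl shiftD opprD addrACA. Qed.

Lemma omegaDl A G G' G2 : omega A (G + G') G2 = omega A G G2 + omega A G' G2.
Proof.
by rewrite /omega grad_diffD mulmxDl !pairingDl opprD addrACA.
Qed.

End GaugeInvariance.

(** * Difference operators *)

Section DifferenceOperatorCoefficients.
Variables (R : realType) (q : R[i]) (n : nat).
Local Notation C := R[i].
Local Notation L := (laurent R).
Hypothesis q0 : q != 0.
Local Notation H i := (@dil R (q ^ i)).
Implicit Types (A B F X : psiD R) (s : int).

Lemma HD (i j : int) (a : L) : H i (H j a) = H (i + j) a.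
Proof. by rewrite dil_comp expfzDr. Qed.

Lemma H0 (a : L) : H 0 a = a.
Proof. by rewrite expr0z dil_one. Qed.

Lemma HM (i : int) (a b : L) : H i (a * b) = H i a * H i b.
Proof. by rewrite dilM// expfz_neq0. Qed.

Lemma dilN (c : C) (a : L) : dil c (- a) = - dil c a.
Proof. exact: raddfN. Qed.

Lemma zintH (i : int) (a b : L) : zint (a * H i b) = zint (H (- i) a * b).
Proof. by rewrite -(zint_dil (q ^ (- i))) HM HD addNr H0. Qed.

(** Contributions of f_l D^-l, with f_l = F(-l), to the coefficient of D^s in B F ([Mterm]) and in F
    B ([Nterm]). *)
Definition Mterm B F s (l : nat) : L := B (s + l) * H (s + l) (F (- l%:Z)).
Definition Nterm F B s (l : nat) : L := F (- l%:Z) * H (- l%:Z) (B (s + l)).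

Lemma psiM_grad_l B F s : supported (fun i => - n%:Z < i <= 0) F ->
  psiM q B F s = \sum_(l < n) Mterm B F s l.
Proof.
move=> F0 /=; rewrite (@fsum_ord _ n (fun l => s + l)).
- by apply: eq_bigr => l _; rewrite /Mterm; congr (_ * H _ (F _)); lia.
- by move=> k l kl; apply: ord_inj; lia.
move=> i il; rewrite F0 ?raddf0 ?mulr0//.
apply/negP => si; have ln : (`|i - s| < n)%N by lia.
by apply: (il (Ordinal ln)) => /=; lia.
Qed.

Lemma psiM_grad_r F B s : supported (fun i => - n%:Z < i <= 0) F ->
  psiM q F B s = \sum_(l < n) Nterm F B s l.
Proof.
move=> F0 /=; rewrite (@fsum_ord _ n (fun l => - l%:Z)).
- by apply: eq_bigr => l _; rewrite /Nterm; congr (_ * H _ (B _)); lia.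
- by move=> k l kl; apply: ord_inj; lia.
move=> i il; rewrite F0 ?mul0r//.
apply/negP => si; have ln : (`|i| < n)%N by lia.
by apply: (il (Ordinal ln)) => /=; lia.
Qed.

(** The trace property in the case that makes the integral of k_00 vanish, so that 1 - h^n can be
    inverted on k_00. *)
Lemma zint_psiM_comm B F : supported (fun i => - n%:Z < i <= 0) F ->
  zint (psiM q B F 0) = zint (psiM q F B 0).
Proof.
move=> F0; rewrite psiM_grad_l// psiM_grad_r// !zint_sum; apply: eq_bigr => l _.
by rewrite /Mterm /Nterm add0r [RHS]zintH opprK mulrC.
Qed.

(** Tr (P_+ X P_- X') for series without powers of D above n. By cyclicity Tr (P_- X P_+ X') is the
    same form with the arguments exchanged. *)
Definition pair_plus (X X' : int -> L) : C :=
  \sum_(r < n) zint (X r.+1%:Z * H r.+1 (X' (- r.+1%:Z))).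

Lemma psi_pairing_supp X X' : (forall i, n%:Z < i -> X i = 0) ->
  (forall i, n%:Z < i -> X' i = 0) ->
  psi_pairing q X X' =
  zint (X 0 * X' 0) + pair_plus X X' + pair_plus X' X.
Proof.
move=> Xn X'n; rewrite /psi_pairing /psi_trace /=.
(* [e] lists the exponents 0, then 1, ..., n, then -1, ..., -n. *)
pose e (l : 'I_(1 + (n + n))) : int :=
  match fintype.split l with inl _ => 0 | inr l' =>
    match fintype.split l' with inl r => r.+1%:Z | inr r => - r.+1%:Z end end.
rewrite (@fsum_ord _ _ e).
- rewrite big_split_ord big_ord1 /= big_split_ord /= !zintD !zint_sum addrA.
  congr (_ + _ + _).
  + by rewrite /e (unsplitK (inl _)) H0 subr0.
  + apply: eq_bigr => r _; rewrite /e (unsplitK (inr _)) (unsplitK (inl _)).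
    by rewrite sub0r.
  apply: eq_bigr => r _; rewrite /e !(unsplitK (inr _)) sub0r opprK zintH opprK.
  by rewrite mulrC.
- move=> k l; rewrite /e; case: (split_ordP k) => k' ->; case: (split_ordP l) => l' ->.
  + by rewrite (ord1 k') (ord1 l').
  + by case: (split_ordP l') => l'' _; lia.
  + by case: (split_ordP k') => l'' _; lia.
  case: (split_ordP k') => k'' ->; case: (split_ordP l') => l'' -> kl.
  + by congr (rshift _ (lshift _ _)); apply: ord_inj; lia.
  + by lia.
  + by lia.
  by congr (rshift _ (rshift _ _)); apply: ord_inj; lia.
move=> i ie; have [ni|ni] := ltP n%:Z i; first by rewrite Xn ?mul0r.
have [ni'|ni'] := ltP n%:Z (- i).
  by rewrite sub0r X'n// raddf0 mulr0.
exfalso; case: (ltgtP i 0) => i0.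
- have rn : (`|i|.-1 < n)%N by lia.
  apply: (ie (rshift 1 (rshift n (Ordinal rn)))).
  by rewrite /e !(unsplitK (inr _)) /=; lia.
- have rn : (`|i|.-1 < n)%N by lia.
  apply: (ie (rshift 1 (lshift n (Ordinal rn)))).
  by rewrite /e (unsplitK (inr _)) (unsplitK (inl _)) /=; lia.
by apply: (ie (lshift (n + n) ord0)); rewrite /e (unsplitK (inl _)).
Qed.

Lemma psi_pairingDl X X' Y : psi_pairing q (X + X') Y =
  psi_pairing q X Y + psi_pairing q X' Y.
Proof.
rewrite /psi_pairing /psi_trace /= -zintD.
have [N XN] := coefs_bounded X; have [N' XN'] := coefs_bounded X'.
have [M YM] := coefs_bounded Y; congr zint.
pose D := [set i : int | - M <= i <= Num.max N N'].
have finD : finite_set D by exact: finite_itv_int.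
have DP (i : int) : ~ D i -> M < 0 - i \/ (N < i /\ N' < i).
  by rewrite /D /=; lia.
rewrite !(@fsum_supp _ D) -?fsbig_split//.
- by apply: eq_fsbigr => i _; rewrite mulrDl.
- by move=> i /DP[/YM ->|[_ /XN' ->]]; rewrite ?raddf0 ?mulr0 ?mul0r.
- by move=> i /DP[/YM ->|[/XN -> _]]; rewrite ?raddf0 ?mulr0 ?mul0r.
by move=> i /DP[/YM ->|[/XN -> /XN' ->]]; rewrite ?raddf0 ?mulr0 ?addr0 ?mul0r.
Qed.

Lemma psi_pairing_0 (f : L -> L) X Y :
  psi_pairing q (psi_0 f X) Y = zint (f (X 0) * Y 0).
Proof.
rewrite /psi_pairing /psi_trace /= (@fsum_supp _ [set 0 : int]).
  by rewrite fsbig_set1 eqxx H0 subr0.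
by move=> i /eqP/negPf ->; rewrite mul0r.
Qed.

Lemma psi_pairing_R X X' : (forall i, n%:Z < i -> X i = 0) ->
  (forall i, n%:Z < i -> X' i = 0) ->
  psi_pairing q (psi_R X) X' = 2^-1 * (pair_plus X X' - pair_plus X' X).
Proof.
move=> Xn X'n.
have RXp r : psi_R X r.+1%:Z = laurentC 2^-1 * X r.+1%:Z.
  by rewrite /= subr0 laurentZ.
have RXn r : psi_R X (- r.+1%:Z) = - (laurentC 2^-1 * X (- r.+1%:Z)).
  by rewrite /= sub0r scalerN laurentZ.
rewrite psi_pairing_supp//; last first.
  move=> i ni; rewrite /psi_R /= !Xn// !if_same subr0 scaler0//.
have R0 : psi_R X 0 = 0 by rewrite /= subr0 scaler0.
rewrite R0 mul0r add0r mulrBr; congr (_ + _).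
  rewrite /pair_plus mulr_sumr; apply: eq_bigr => r _.
  by rewrite RXp -mulrA zintZ.
rewrite /pair_plus mulr_sumr -sumrN; apply: eq_bigr => r _.
rewrite RXn dilN mulrN HM dilC mulrCA.
by rewrite -zintZ.
Qed.

End DifferenceOperatorCoefficients.

(** * Gradients at companion matrices *)

Lemma sum_ord_trunc (V : zmodType) (p n : nat) (t : nat -> V) : (p <= n)%N ->
  (forall l, (p <= l)%N -> t l = 0) -> \sum_(l < n) t l = \sum_(l < p) t l.
Proof.
move=> pn t0; rewrite (big_ord_widen n t pn) [RHS]big_mkcond /=.
by apply: eq_bigr => l _; case: ltnP => // /t0.
Qed.

(** Substitute p = r + l + 1; the square on the right exceeds the triangle only where p > n, and
    there Y vanishes. *)
Lemma sum_triangle (V : zmodType) (n : nat) (Y : nat -> nat -> V) :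
  (forall p l, (n < p)%N -> Y p l = 0) ->
  \sum_(p < n.+1) \sum_(l < p) Y p l = \sum_(r < n) \sum_(l < n) Y (r + l).+1 l.
Proof.
move=> Y0; rewrite [RHS]exchange_big /=.
transitivity (\sum_(p < n.+1) \sum_(l < n) if (l < p)%N then Y p l else 0).
  by apply: eq_bigr => p _; rewrite (big_ord_widen n (Y p)) ?big_mkcond// -ltnS.
rewrite exchange_big; apply: eq_bigr => l _.
rewrite -(big_mkord xpredT (fun p => if (l < p)%N then Y p l else 0)).
rewrite (@big_cat_nat _ _ _ l.+1) ?ltnS 1?ltnW//=.
rewrite big_nat_cond big1 ?add0r => [|p]; last first.
  by rewrite andbT /= ltnS => pl; rewrite ltnNge pl.
rewrite -{1}[l.+1]add0n big_addn subSS big_mkord.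
rewrite -(@sum_ord_trunc _ (n - l) n (fun r => if (l < r + l.+1)%N then Y (r + l.+1)%N l else 0)).
- by apply: eq_bigr => r _; rewrite ifT ?addnS// ltnS leq_addl.
- exact: leq_subr.
by move=> r nlr; rewrite Y0 ?if_same//; lia.
Qed.

Lemma grad_diffE (R : realType) (q : R[i]) (n : nat) (A G : 'M[laurent R]_n) i j :
  grad_diff q A G i j = dil q^-1 ((A *m G) i j) - (G *m A) i j.
Proof. by rewrite /grad_diff mxE [X in X + _]mxE [X in _ + X]mxE. Qed.

Lemma grad_diffDE (R : realType) (q : R[i]) (n : nat) (A G G' : 'M[laurent R]_n) i j :
  grad_diff q A (G + G') i j = grad_diff q A G i j + grad_diff q A G' i j.
Proof. by rewrite grad_diffD mxE. Qed.

Lemma mulmx_companion (R : realType) (m : nat) (B : psiD R)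
    (X : 'M[laurent R]_m.+1) (i j : 'I_m.+1) : (X *m companion m.+1 B) i j =
  - X i ord0 * B (m%:Z - j%:Z) + (if (j < m)%N then X i (inord j.+1) else 0).
Proof.
rewrite mxE big_ord_recl mxE eqxx mulrN mulNr; congr (- (_ * B _) + _); first lia.
case: ltnP => jm.
  rewrite (bigD1 (Ordinal jm))//= big1 ?addr0 => [|k kj].
    rewrite mxE /= eqxx mulr1; congr (X _ _); apply: ord_inj.
    by rewrite inordK ?lift0.
  rewrite mxE /= /bump /= add1n eqSS (_ : (_ == _) = false) ?mulr0//.
  by apply/negP => /eqP kE; move/eqP: kj; apply; apply: ord_inj.
rewrite big1// => k _; rewrite mxE /= /bump /= add1n eqSS.
rewrite (_ : (_ == _) = false) ?mulr0//; have := ltn_ord k; lia.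
Qed.

Section Companion.
Variables (R : realType) (q : R[i]) (m : nat).
Local Notation C := R[i].
Local Notation L := (laurent R).
Local Notation n := m.+1.
Local Notation gl := 'M[laurent R]_n.
Local Notation H i := (@dil R (q ^ i)).
Hypothesis q0 : q != 0.

Section Gradient.
Variables (B F : psiD R).
Hypotheses (MB : Mspace n B) (F0 : supported (fun i => - n%:Z < i <= 0) F).

Local Notation t s l := (Nterm q F B s l).
Definition Nr (F B : psiD R) (s : int) : L := \sum_(l < n) Nterm q F B s l.
Definition Nl (B F : psiD R) (s : int) : L := \sum_(l < n) Mterm q B F s l.

Let Bn : B n = 1. Proof. by case: MB. Qed.
Let Bout i : ~~ (0 <= i <= n%:Z) -> B i = 0. Proof. by case: MB => _; exact. Qed.

(* Row [i] of [Ghat] lists the coefficients of                              *)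
(* [D^p (- P_+(F B) + sum_(l < p) f_l D^-l B) D^-1], [p = m - i], with       *)
(* [F = sum_l f_l D^-l]: it is the extension of the gradient [F] for which   *)
(* [grad_diff] lives in the first row.                                       *)
Definition Dsum (p : nat) (s : int) : L :=
  \sum_(l < p) t s l - (if 0 < s then Nr F B s else 0).
Definition Ghat : gl :=
  \matrix_(i, j) H (m - i)%N (Dsum (m - i) (i.+1%:Z - j%:Z)).

Lemma DsumS (p : nat) (s : int) : Dsum p.+1 s = Dsum p s + t s p.
Proof. by rewrite /Dsum big_ord_recr /= addrAC. Qed.

Lemma Dsum_top s : s <= 0 -> Dsum n s = Nr F B s.
Proof. by move=> s0; rewrite /Dsum ifF ?subr0//; lia. Qed.

(** Since B has order n and is monic, the coefficient of D^s in F B ends with the term l = p, which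
    is f_p. This is how the first column of [Ghat] comes to be the gradient. *)
Lemma Dsum_col (p : nat) (s : int) : p%:Z + s = n%:Z -> 0 < s -> Dsum p s = - F (- p%:Z).
Proof.
move=> psn s0; rewrite /Dsum s0 /Nr (@sum_ord_trunc _ p.+1 n (fun l => t s l)).
- rewrite big_ord_recr /= opprD addrA subrr add0r /Nterm addrC psn Bn.
  by rewrite dil1 mulr1.
- by lia.
by move=> l pl; rewrite /Nterm Bout ?raddf0 ?mulr0//; lia.
Qed.

Lemma Dsum_neg p : Dsum p (- p%:Z) = 0.
Proof.
rewrite /Dsum ifF ?subr0; last by lia.
by rewrite big1// => l _; rewrite /Nterm Bout ?raddf0 ?mulr0//; have := ltn_ord l; lia.
Qed.

Lemma Ghat_col (i : 'I_n) : Ghat i ord0 = - H (m - i)%N (F (- (m - i)%N%:Z)).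
Proof.
by rewrite mxE Dsum_col ?dilN// /=; have := ltn_ord i; lia.
Qed.

(** Right multiplication by the companion matrix shifts row i and adds h^p f_p times coefficients of
    B, p = m - i: this is the next summand f_p D^-p B. Left multiplication followed by h^-1 turns
    row i - 1 into the same expression, hence k vanishes in row i > 0. *)
Lemma Ghat_mul_companion (i j : 'I_n) : (Ghat *m companion n B) i j =
  H (m - i)%N (Dsum (m - i).+1 (i%:Z - j%:Z)).
Proof.
have im := ltn_ord i; have jm := ltn_ord j.
rewrite mulmx_companion Ghat_col opprK DsumS [RHS]raddfD /= addrC; congr (_ + _).
  case: ltnP => jm'; first by rewrite mxE inordK//; congr (H _ (Dsum _ _)); lia.
  rewrite (_ : i%:Z - j%:Z = - (m - i)%N%:Z); last by lia.
  by rewrite Dsum_neg raddf0.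
rewrite /Nterm HM// HD// subrr H0; congr (_ * B _); lia.
Qed.

Lemma grad_diff_Ghat (i j : 'I_n) : (0 < i)%N ->
  grad_diff q (companion n B) Ghat i j = 0.
Proof.
move=> i0; have im := ltn_ord i.
rewrite grad_diffE Ghat_mul_companion mul_companion// mxE inordK; last by lia.
apply/eqP; rewrite subr_eq0; apply/eqP.
rewrite -[q^-1]/(q ^ (-1)) (HD q0).
rewrite (_ : -1 + _ = (m - i)%N%:Z); last by lia.
rewrite (_ : (m - i.-1)%N = (m - i).+1); last by lia.
by rewrite (_ : _.-1.+1%:Z = i%:Z); last by lia.

Qed.

Definition kap (j : 'I_n) : L := grad_diff q (companion n B) Ghat ord0 j.

(** The coefficient of D^s in B P_+(F B) - P_+(B F) B, the Adler map of the second Gelfand-Dickey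
    structure, with strictly positive parts. *)
Definition Vcoef (s : int) : L := \sum_(r < n)
  (B (s - r.+1%:Z) * H (s - r.+1%:Z) (Nr F B r.+1%:Z)
   - Nl B F r.+1%:Z * H r.+1%:Z (B (s - r.+1%:Z))).

Lemma companion0_Ghat j : (companion n B *m Ghat) ord0 j =
  - \sum_(p < n) B p%:Z * H p (Dsum p (n%:Z - j%:Z - p%:Z)).
Proof.
rewrite mxE (reindex_inj rev_ord_inj) -sumrN; apply: eq_bigr => p _.
have pm := ltn_ord p; rewrite [companion _ _ _ _]mxE.
rewrite [Ghat _ _]mxE.
rewrite eqxx mulNr /=.
rewrite (_ : n%:Z - _ - 1 = p%:Z); last by lia.
rewrite (_ : (m - _)%N = p); last by lia.
by rewrite (_ : _ - j%:Z = n%:Z - j%:Z - p%:Z); last by lia.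
Qed.

Lemma kapE j : dil q (kap j) =
  (companion n B *m Ghat) ord0 j - H n (Nr F B (- j%:Z)).
Proof.
rewrite /kap grad_diffE Ghat_mul_companion raddfB /=; congr (_ - _).
  exact: dilK.
rewrite subn0 -[q in dil q _]expr1z HD// Dsum_top; last by lia.
by congr (H _ (Nr _ _ _)); lia.
Qed.

Lemma kap0 : dil q (kap ord0) = Nl B F 0 - H n (Nr F B 0).
Proof.
rewrite kapE companion0_Ghat; congr (_ - _); rewrite -sumrN; apply: eq_bigr => p _.
rewrite Dsum_col /=; [|lia|by have := ltn_ord p; lia].
by rewrite dilN mulrN opprK /Mterm add0r.
Qed.

Lemma kapV j : dil q (kap j) = Vcoef (n%:Z - j%:Z).
Proof.
have jm := ltn_ord j.
rewrite kapE companion0_Ghat /Vcoef; set s := n%:Z - j%:Z.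
have [s' sE] : exists s' : nat, s = s' by exists (n - j)%N; rewrite /s; lia.
have s1 : (0 < s' <= n)%N by lia.
(* [Y p l] is the coefficient of D^s in B_p D^p f_l D^-l B; the pairs with l < p make up P_+(B F)
   B. *)
pose Y (p l : nat) := B p%:Z * H p (t (s - p%:Z) l).
have Ytri : \sum_(r < n) Nl B F r.+1%:Z * H r.+1%:Z (B (s - r.+1%:Z)) =
    \sum_(p < n) B p%:Z * H p (\sum_(l < p) t (s - p%:Z) l) + H n (Nr F B (- j%:Z)).
  transitivity (\sum_(r < n) \sum_(l < n) Y (r + l).+1 l).
    apply: eq_bigr => r _; rewrite /Nl mulr_suml; apply: eq_bigr => l _.
    rewrite /Y /Mterm /Nterm (HM q0) (HD q0) mulrA.
    rewrite (_ : (r + l).+1%:Z = r.+1%:Z + l%:Z); last by lia.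
    by rewrite addrK opprD addrA subrK.
  rewrite -sum_triangle; last by move=> p l np; rewrite /Y Bout ?mul0r//; lia.
  rewrite big_ord_recr /=; congr (_ + _).
    by apply: eq_bigr => p _; rewrite raddf_sum mulr_sumr.
  rewrite /Y -mulr_sumr Bn mul1r /Nr raddf_sum; apply: eq_bigr => l _ /=.
  by rewrite (_ : s - n%:Z = - j%:Z); last by rewrite /s; lia.
(* [U] and [U'] index B P_+(F B) by the exponent of the factor B and by that of P_+(F B), related by
   p + r + 1 = s. *)
pose U (p : nat) := B p%:Z * H p (if 0 < s - p%:Z then Nr F B (s - p%:Z) else 0).
pose U' (r : nat) := B (s - r.+1%:Z) * H (s - r.+1%:Z) (Nr F B r.+1%:Z).
have Dsplit : \sum_(p < n) B p%:Z * H p (Dsum p (s - p%:Z)) =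
    \sum_(p < n) B p%:Z * H p (\sum_(l < p) t (s - p%:Z) l) - \sum_(p < n) U p.
  by rewrite -sumrB; apply: eq_bigr => p _; rewrite /Dsum raddfB /= mulrBr.
have UU' : \sum_(p < n) U p = \sum_(r < n) U' r.
  rewrite (@sum_ord_trunc _ s' n U); last 2 first.
  - by lia.
  - by move=> p sp; rewrite /U ifF ?raddf0 ?mulr0//; lia.
  rewrite (@sum_ord_trunc _ s' n U'); last 2 first.
  - by lia.
  - by move=> r sr; rewrite /U' Bout ?mul0r//; lia.
  rewrite (reindex_inj rev_ord_inj); apply: eq_bigr => r _.
  have rs := ltn_ord r; rewrite /U /U' /= ifT; last by lia.
  rewrite (_ : (s' - r.+1)%N%:Z = s - r.+1%:Z); last by lia.
  by rewrite subKr.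
by rewrite sumrB Ytri Dsplit UU' opprB opprD addrA.
Qed.

End Gradient.

End Companion.

(** * Potentials at companion matrices and the strictly upper triangular freedom *)

Section CompanionPairing.
Variables (R : realType) (q : R[i]) (m : nat).
Local Notation C := R[i].
Local Notation L := (laurent R).
Local Notation n := m.+1.
Local Notation gl := 'M[laurent R]_n.
Local Notation H i := (@dil R (q ^ i)).
Hypotheses (q_gt0 : 0 < `|q|) (q_lt1 : `|q| < 1).

Let q0 : q != 0. Proof. by rewrite -normr_gt0. Qed.

Let dil_H1 (a : L) : dil q a = H 1 a. Proof. by rewrite expr1z. Qed.

(* [(1 + h^n) / (1 - h^n)] as a multiplier; division by zero makes it vanish on *)
(* constants, as it must.                                                      *)
Definition theta (k : int) : C := (1 + (q ^ n) ^ k) / (1 - (q ^ n) ^ k).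

Lemma qn_expz_neq1 (k : int) : k != 0 -> 1 - (q ^ n) ^ k != 0.
Proof.
move=> k0; rewrite subr_eq0 eq_sym (_ : (q ^ n) ^ k = (q ^ k) ^+ n).
  exact: (@qn_neq1 R q n isT q_lt1 k k0).
by rewrite -[RHS]/((q ^ k) ^ n%:Z) !exprz_exp mulrC.
Qed.

Definition pot0 (c : L) : L := mult (fun k => (1 - (q ^ n) ^ k)^-1) c.

Lemma pot0B (c : L) : zint c = 0 -> pot0 c - H n (pot0 c) = c.
Proof.
move=> c0; apply: seriesP => k; rewrite laurentD laurentN /=.
(* At k = 0 the multiplier is 0^-1 = 0, and the hypothesis makes c vanish there as well. *)
have [->|k0] := eqVneq k 0; first by rewrite [c 0]c0; ring.
rewrite -[X in X - _]mul1r -mulrBl mulrA mulfV ?mul1r//; exact: qn_expz_neq1.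
Qed.

Lemma pot0D (c : L) : zint c = 0 -> pot0 c + H n (pot0 c) = mult theta c.
Proof.
move=> c0; apply: seriesP => k; rewrite laurentD /=.
by rewrite /theta -[X in X + _]mul1r -mulrDl mulrA.
Qed.

(** For a diagonal concentrated in the entry c at (0, 0), a potential satisfies a_i = h a_(i+1) for
    i > 0, so a_i = h^(n-i) a_0, and closing the cycle gives a_0 - h^n a_0 = c. *)
Definition pot (c : L) (i : 'I_n) : L :=
  if i == ord0 then pot0 c else H (n - i)%N (pot0 c).

Lemma dil_pot_ordS c i : dil q (pot c (ordS i)) = H (n - i)%N (pot0 c).
Proof.
have im := ltn_ord i; have [e|ne] := eqVneq (i : nat) m.
  rewrite (_ : ordS i = ord0); last by apply: ord_inj; rewrite /= e modnn.
  by rewrite /pot eqxx e subSnn expr1z.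
have iS : ordS i = i.+1 :> nat by rewrite /= modn_small//; lia.
rewrite /pot ifF; last first.
  by apply/negP => /eqP /(congr1 (@nat_of_ord _)); rewrite iS.
rewrite iS -[q in dil q _]expr1z (HD q0).
by rewrite (_ : 1 + _ = (n - i)%N%:Z); last by lia.
Qed.

Lemma potential_pot (K : gl) (c : L) : zint c = 0 -> K ord0 ord0 = c ->
  (forall i, i != ord0 -> K i i = 0) -> potential q (pot c) K.
Proof.
move=> c0 K0 KS i; rewrite dil_pot_ordS /pot; case: eqVneq => [->|/KS ->].
  by rewrite subn0 pot0B.
by rewrite subrr.
Qed.

(** The sum telescopes around the cycle and retains only a_0. A correction whose potential vanishes
    at index 0 is therefore invisible to Delta. *)
Lemma kappa_potential (K : gl) a : potential q a K ->
  kappa q K = a ord0 - H n (a ord0).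
Proof.
move=> pa; pose b (k : nat) := H k (a (inord (k %% n)%N)).
rewrite /kappa (eq_bigr (fun i : 'I_n => - (b i.+1 - b i))); last first.
  move=> i _; have im := ltn_ord i; rewrite pa opprB raddfB /= /b; congr (_ - _).
    by rewrite modn_small// inord_val.
  rewrite dil_comp -exprSr; congr (dil _ (a _)); apply: ord_inj.
  by rewrite inordK// ltn_mod.
rewrite sumrN -(big_mkord xpredT (fun i => b i.+1 - b i)) telescope_sumr// opprB.
rewrite /b modnn mod0n H0; congr (a _ - H _ (a _)); apply: ord_inj;
  by rewrite inordK.
Qed.

Definition potform (a b : 'I_n -> L) : C :=
  \sum_i zint ((a i + dil q (a (ordS i))) * (b i - dil q (b (ordS i)))).

(** The Cayley transform of an isometry is skew; this is that fact expressed in potentials. *)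
Lemma potformC a b : potform b a = - potform a b.
Proof.
apply/eqP; rewrite -addr_eq0 -big_split /=; apply/eqP.
have e i : zint ((b i + dil q (b (ordS i))) * (a i - dil q (a (ordS i)))) +
    zint ((a i + dil q (a (ordS i))) * (b i - dil q (b (ordS i)))) =
    (zint (a i * b i) - zint (a (ordS i) * b (ordS i))) *+ 2.
  rewrite -(zint_dil q (a (ordS i) * _)) dilM// mulr2n.
  rewrite /zint -!laurentN -!laurentD; congr ((_ : L) 0); ring.
under eq_bigr do rewrite e.
rewrite sumrMnl sumrB [X in X - _](reindex (@ordS n)) ?subrr ?mul0rn//.
exact: onW_bij (ordS_bij n).
Qed.

Lemma potformDl a a' b : potform (fun i => a i + a' i) b = potform a b + potform a' b.
Proof.
rewrite -big_split; apply: eq_bigr => i _ /=; rewrite -zintD -mulrDl raddfD /=.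
by rewrite [in LHS]addrACA.
Qed.

Variable B : psiD R.
Hypothesis MB : Mspace n B.
Local Notation CB := (companion n B).

Section Strict.
Variables (Y G : gl).
Hypotheses (Y0 : forall i, Y i ord0 = 0) (uY : upper (grad_diff q CB Y)).
Hypothesis uG : upper (grad_diff q CB G).

(** Below the diagonal, vanishing of k reads h^-1 Y_(i-1,j) = Y_(i,j+1), which propagates the zero
    first column to the right. *)
Lemma strict_upper (i j : 'I_n) : (j <= i)%N -> Y i j = 0.
Proof.
move: i; case: j => j jm; elim: j jm => [|j IH] jm i ji.
  by rewrite -[RHS](Y0 i); congr (Y _ _); apply: ord_inj.
rewrite /= in ji; have im := ltn_ord i; have jm' : (j < n)%N by lia.
have := @uY i (Ordinal jm') ji; rewrite grad_diffE mul_companion; last by lia.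
rewrite IH; last by rewrite inordK /=; lia.
rewrite raddf0 sub0r mulmx_companion Y0 oppr0 mul0r add0r /= ifT => [/eqP|]; last by lia.
rewrite oppr_eq0 => /eqP Yij; rewrite -[RHS]Yij; congr (Y _ _).
by apply: ord_inj; rewrite inordK.
Qed.

(** As the first column of Y is zero, (Y C)_ii = Y_(i,i+1) = (C Y)_(i+1,i+1) for i < m, so the
    diagonal of h^-1(C Y) is a potential for k, and it vanishes at index 0. *)
Definition strict_pot (i : 'I_n) : L := dil q^-1 ((CB *m Y) i i).

Lemma strict_pot0 : strict_pot ord0 = 0.
Proof.
rewrite /strict_pot mxE big1 ?raddf0// => l _.
by rewrite Y0 mulr0.
Qed.

Lemma strict_potS i : (Y *m CB) i i = dil q (strict_pot (ordS i)).
Proof.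
have im := ltn_ord i; rewrite mulmx_companion Y0 oppr0 mul0r add0r.
have [e|ne] := eqVneq (i : nat) m.
  rewrite (_ : ordS i = ord0); last by apply: ord_inj; rewrite /= e modnn.
  by rewrite strict_pot0 raddf0 e ltnn.
have iS : ordS i = i.+1 :> nat by rewrite /= modn_small//; lia.
rewrite ifT; last by lia.
rewrite /strict_pot dilK// mul_companion iS//; congr (Y _ _); apply: ord_inj.
  by rewrite inordK.
by rewrite inordK; lia.
Qed.

Lemma potential_strict : potential q strict_pot (grad_diff q CB Y).
Proof. by move=> i; rewrite grad_diffE strict_potS. Qed.

Lemma upper_strict_mul : upper (Y *m CB).
Proof.
move=> i j ji; rewrite mulmx_companion Y0 oppr0 mul0r add0r.
by case: ltnP => // jm; rewrite strict_upper// inordK.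
Qed.

(** By [omegaE] only the diagonals of h^-1(C Y) and Y C enter, which are a_i and h a_(i+1). The
    result is the negative of the Cayley term of Y, so that the two cancel in the bracket. *)
Lemma omega_strict b : potential q b (grad_diff q CB G) ->
  omega q CB Y G = - potform strict_pot b.
Proof.
move=> pb; have uC : upper (shift q^-1 (CB *m Y)).
  move=> i j ji; have := uY ji; rewrite grad_diffE upper_strict_mul// subr0.
  by move=> e; rewrite mxE.
rewrite omegaE// pairing_upper// pairing_upper//; last exact: upper_strict_mul.
congr (- _); rewrite -big_split; apply: eq_bigr => i _ /=.
by rewrite -zintD -mulrDl pb mxE strict_potS.
Qed.

End Strict.

Section Pair.
Variables (F F2 : psiD R).
Hypothesis F0 : supported (fun i => - n%:Z < i <= 0) F.
Hypothesis F20 : supported (fun i => - n%:Z < i <= 0) F2.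
Local Notation Gh F := (Ghat q m B F).
Local Notation kp F := (@kap R q m B F).
Local Notation NL F := (Nl q m B F).
Local Notation NR F := (Nr q m F B).

Let Bout i : ~~ (0 <= i <= n%:Z) -> B i = 0. Proof. by case: MB => _; exact. Qed.

(** Cyclicity of the trace: Tr (B P_+(F2 B) F) = Tr (P_+(F2 B) F B), while P_+(B F2) B F already has
    the required form. *)
Lemma Vcoef_pairing : \sum_(s < n) zint (Vcoef q m B F2 s * H s (F (- s%:Z))) =
  pair_plus q n (NR F2) (NR F) - pair_plus q n (NL F2) (NL F).
Proof.
rewrite /pair_plus -sumrB /Vcoef.
transitivity (\sum_(s < n) \sum_(r < n)
   zint ((B (s%:Z - r.+1%:Z) * H (s%:Z - r.+1%:Z) (NR F2 r.+1%:Z)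
   - NL F2 r.+1%:Z * H r.+1%:Z (B (s%:Z - r.+1%:Z))) * H s (F (- s%:Z)))).
  by apply: eq_bigr => s _; rewrite mulr_suml zint_sum.
rewrite exchange_big; apply: eq_bigr => r _ /=.
rewrite [X in H _ X]/(Nr _ _ F B _) [X in _ - zint (_ * H _ X)]/(Nl _ _ B F _).
rewrite [H _ (\sum_(l < n) Nterm _ F _ _ _)]raddf_sum.
rewrite [H _ (\sum_(l < n) Mterm _ _ F _ _)]raddf_sum.
rewrite !mulr_sumr !zint_sum -sumrB; apply: eq_bigr => s _ /=.
rewrite mulrBl -[zint (_ - _)]/(zint _ - zint _); congr (_ - _).
  rewrite /Nterm (HM q0) (HD q0) -(zint_dil (q ^ (r.+1%:Z - s%:Z))) !(HM q0) !(HD q0).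
  rewrite subrK addrA subrK subrr H0.
  rewrite (_ : - r.+1%:Z + s%:Z = s%:Z - r.+1%:Z); last by rewrite addrC.
  by rewrite /zint; congr ((_ : L) 0); ring.
rewrite /Mterm (HM q0) (HD q0) -mulrA.
rewrite (_ : - r.+1%:Z + s%:Z = s%:Z - r.+1%:Z); last by rewrite addrC.
by rewrite (_ : r.+1%:Z + (s%:Z - r.+1%:Z) = s%:Z)// addrC subrK.
Qed.

(** The first column of Ghat C consists of h^m (F B)_0 on top and of -h^(m-j) f_(n-j) in row j > 0,
    so beyond its first term the sum is minus the trace of the Adler map of F2 against F. *)
Lemma col_pairing : \sum_j zint (kp F2 j * (Gh F *m CB) j ord0) =
  zint ((NL F2 0 - H n (NR F2 0)) * H n (NR F 0))
  - (pair_plus q n (NR F2) (NR F) - pair_plus q n (NL F2) (NL F)).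
Proof.
rewrite -Vcoef_pairing big_ord_recl; congr (_ + _).
  rewrite Ghat_mul_companion// -(zint_dil q) dilM// kap0// subn0 Dsum_top; last by lia.
  rewrite dil_H1 (HD q0) subr0.
  by rewrite (_ : 1 + _ = n%:Z); last by lia.
exact: q0.
rewrite big_ord_recl (_ : Vcoef _ _ _ _ _ = 0); last first.
  rewrite /Vcoef big1// => r _; rewrite !Bout ?mul0r ?raddf0 ?mulr0 ?subr0//=; lia.
rewrite mul0r [zint 0]/(0 : C) add0r -sumrN (reindex_inj rev_ord_inj).
apply: eq_bigr => k _; have km := ltn_ord k.
rewrite Ghat_mul_companion// Dsum_col//; last first.
  by rewrite !lift0 /=; lia.
rewrite dilN mulrN -[zint (- _)]/(- zint _); congr (- _).
rewrite -(zint_dil q) dilM// kapV// dil_H1 (HD q0) !lift0 /=.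
rewrite (_ : n%:Z - (m - k.+1).+1%:Z = k.+1%:Z); last by lia.
rewrite (_ : (m - (m - k.+1).+1)%N = k); last by lia.
by rewrite (_ : 1 + k%:Z = k.+1%:Z).
Qed.

End Pair.

End CompanionPairing.

(** * The bracket at a companion matrix *)

Section Reduction.
Variables (R : realType) (q : R[i]) (m : nat).
Local Notation C := R[i].
Local Notation L := (laurent R).
Local Notation n := m.+1.
Local Notation gl := 'M[laurent R]_n.
Local Notation H i := (@dil R (q ^ i)).
Hypotheses (q_gt0 : 0 < `|q|) (q_lt1 : `|q| < 1).
Implicit Types (F : psiD R) (G : gl).

Let q0 : q != 0. Proof. by rewrite -normr_gt0. Qed.

Local Notation NL B F := (Nl q m B F).
Local Notation NR B F := (Nr q m F B).
Local Notation suppF := (supported (fun i => - n%:Z < i <= 0)).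

Section AtCompanion.
Variable B : psiD R.
Hypothesis MB : Mspace n B.
Local Notation CB := (companion n B).
Local Notation Gh F := (Ghat q m B F).
Local Notation kp F := (@kap R q m B F).
Local Notation pt F := (@pot R q m (kp F ord0)).

Let Bout i : ~~ (0 <= i <= n%:Z) -> B i = 0. Proof. by case: MB => _; exact. Qed.

(** Only the first column of G is prescribed. The sign reflects the first row -u of the companion
    matrix, and h^p f_p is what the coefficient of D^p pairs with in Tr X F. *)
Definition extends_grad F G : Prop :=
  forall i, G i ord0 = - H (m - i)%N (F (- (m - i)%N%:Z)).

Lemma zint_kap F : suppF F -> zint (kp F ord0) = 0.
Proof.
move=> F0; rewrite -(zint_dil q) kap0//.
rewrite -[zint (_ - _)]/(zint _ - zint _) zint_dil.
have := @zint_psiM_comm R q n q0 B F F0.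
by rewrite (psiM_grad_l q0 _ _ F0) (psiM_grad_r q0 _ _ F0) => ->; rewrite subrr.
Qed.

Lemma upper_Ghat F : suppF F -> upper (grad_diff q CB (Gh F)).
Proof. by move=> F0 i j ji; rewrite grad_diff_Ghat//; case: i ji => -[]. Qed.

Lemma grad_split F G : suppF F -> extends_grad F G -> upper (grad_diff q CB G) ->
  exists Y, [/\ G = Gh F + Y, forall i, Y i ord0 = 0 & upper (grad_diff q CB Y)].
Proof.
move=> F0 FG uG; exists (G - Gh F); have GE : Gh F + (G - Gh F) = G.
  by rewrite addrC subrK.
split=> [|i|i j ji]; first by rewrite GE.
  by rewrite mxE [(- Gh F) i ord0]mxE Ghat_col// FG subrr.
have e := congr1 (fun M => grad_diff q CB M i j) GE.
have e' := etrans (esym (grad_diffDE q CB (Gh F) (G - Gh F) i j)) (etrans e (uG i j ji)).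
by have := etrans (esym (congr1 (+%R^~ _) (upper_Ghat F0 ji))) e'; rewrite add0r.
Qed.

Lemma potential_Ghat F : suppF F -> potential q (pt F) (grad_diff q CB (Gh F)).
Proof.
move=> F0; apply: potential_pot => //; first exact: zint_kap.
by move=> i i0; rewrite grad_diff_Ghat// lt0n.
Qed.

Section OneGradient.
Variables (F : psiD R) (Y : gl).
Hypotheses (F0 : suppF F) (Y0 : forall i, Y i ord0 = 0).
Hypothesis uY : upper (grad_diff q CB Y).

Definition grad_pot : 'I_n -> L :=
  fun i => pot q (kp F ord0) i + strict_pot q B Y i.

Lemma potential_grad : potential q grad_pot (grad_diff q CB (Gh F + Y)).
Proof.
move=> i; rewrite grad_diffDE (potential_Ghat F0).
by rewrite (potential_strict q_gt0 q_lt1 _ Y0) /grad_pot raddfD /= opprD addrACA.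
Qed.

Lemma kappa_grad : kappa q (grad_diff q CB (Gh F + Y)) = kp F ord0.
Proof.
rewrite (kappa_potential potential_grad) /grad_pot strict_pot0; last exact: Y0.
by rewrite addr0 /pot eqxx pot0B// zint_kap.
Qed.

Lemma potform_grad G2 b : upper (grad_diff q CB G2) -> potential q b (grad_diff q CB G2) ->
  potform q grad_pot b + omega q CB (Gh F + Y) G2 =
  potform q (pt F) b + omega q CB (Gh F) G2.
Proof.
move=> uG2 pb; rewrite omegaDl potformDl.
rewrite (omega_strict q_gt0 q_lt1 Y0 uY uG2 pb).
by rewrite addrACA subrr addr0.
Qed.

End OneGradient.

Variable delta : int -> C.

Lemma grad_facts F G : suppF F -> extends_grad F G -> upper (grad_diff q CB G) ->
  exists a, [/\ potential q a (grad_diff q CB G),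
    kappa q (grad_diff q CB G) = kp F ord0 &
    forall G2 b, upper (grad_diff q CB G2) -> potential q b (grad_diff q CB G2) ->
      potform q a b + omega q CB G G2 =
      potform q (pt F) b + omega q CB (Gh F) G2].
Proof.
move=> F0 FG uG; have [Y [GE Y0 uY]] := grad_split F0 FG uG; exists (grad_pot F Y).
by rewrite GE; split; [exact: potential_grad|exact: kappa_grad|exact: potform_grad].
Qed.

Lemma potform_Ghat F F2 : suppF F -> suppF F2 ->
  potform q (pt F) (pt F2) =
  zint (mult (theta q m) (kp F ord0) * kp F2 ord0).
Proof.
move=> F0 F20; have pE i := esym (potential_Ghat F20 i).
rewrite /potform big_ord_recl big1 ?addr0 => [|i _]; last first.
  by apply: (etrans (congr1 (fun x => zint (_ * x)) (pE _)));
    rewrite grad_diff_Ghat// mulr0.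
apply: (etrans (congr1 (fun x => zint (_ * x)) (pE _))).
by rewrite (dil_pot_ordS q_gt0 q_lt1) subn0 {1}/pot eqxx pot0D// zint_kap.
Qed.

(** The sum of [potform] and [omega] is skew, so the strictly upper triangular part, removed from
    the first gradient, can be removed from the second one in the same way. *)
Lemma grad_form_companion F F2 G G2 : suppF F -> suppF F2 ->
  extends_grad F G -> extends_grad F2 G2 ->
  upper (grad_diff q CB G) -> upper (grad_diff q CB G2) ->
  grad_form q delta CB G G2 =
  2^-1 * (zint (mult (theta q m) (kp F ord0) * kp F2 ord0) + omega q CB (Gh F) (Gh F2))
  + zint (mult delta (kp F ord0) * kp F2 ord0).
Proof.
move=> F0 F20 FG FG2 uG uG2.
have [a [pa ka aE]] := grad_facts F0 FG uG.
have [b [pb kb bE]] := grad_facts F20 FG2 uG2.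
rewrite (@grad_formE _ q n isT q_gt0 q_lt1 _ _ _ _ _ _ pa pb) ka kb.
have sE : \sum_i zint ((a i + dil q (a (ordS i))) * grad_diff q CB G2 i i) = potform q a b.
  by apply: eq_bigr => i _; rewrite (pb i).
have -> : \sum_i zint ((a i + dil q (a (ordS i))) * grad_diff q CB G2 i i) +
    omega q CB G G2 = - (potform q b (pt F) + omega q CB G2 (Gh F)).
  rewrite sE (aE _ _ uG2 pb) (potformC q_gt0 b (pt F)) (omegaC q CB G2 (Gh F)).
  by rewrite -opprD.
rewrite (bE _ _ (upper_Ghat F0) (potential_Ghat F0)).
rewrite opprD -(omegaC q CB (Gh F2) (Gh F)) -(potformC q_gt0 (pt F2) (pt F)).
by rewrite potform_Ghat.
Qed.

Lemma omega_Ghat F F2 : suppF F -> suppF F2 ->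
  omega q CB (Gh F) (Gh F2) =
  zint ((NL B F 0 - H n (NR B F 0)) * H n (NR B F2 0))
  - zint ((NL B F2 0 - H n (NR B F2 0)) * H n (NR B F 0))
  + (pair_plus q n (NL B F) (NL B F2) - pair_plus q n (NL B F2) (NL B F))
  - (pair_plus q n (NR B F) (NR B F2) - pair_plus q n (NR B F2) (NR B F)).
Proof.
move=> F0 F20.
have e (X X' : psiD R) : suppF X -> suppF X' ->
    pairing (grad_diff q CB (Gh X)) (Gh X' *m CB) =
    \sum_j zint (kp X j * (Gh X' *m CB) j ord0).
  move=> X0 X'0; rewrite pairingE big_ord_recl [X in _ + X]big1 ?addr0// => i _.
  by rewrite big1// => j _; rewrite grad_diff_Ghat// mul0r.
rewrite /omega [X in _ - X]pairingC !e// !col_pairing//.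
by move: (pair_plus _ _ _ _) (pair_plus _ _ _ _) (pair_plus _ _ _ _) => *; ring.
Qed.

End AtCompanion.

Section Multipliers.
Variable delta : int -> C.

Definition Theta (k : int) : C := 2^-1 * theta q m k + delta k.
Definition opa := mult Theta.
Definition opb := mult (fun k => - (q ^ n) ^ k * (Theta k + 2^-1)).
Definition opc := mult (fun k => ((q ^ n) ^ k)^-1 * (Theta k - 2^-1)).
Definition opd := mult (fun k => - Theta k).

(** Expanding P and P2 in the Theta term distributes Theta over all four operators. In the skew term
    the products N' N2' cancel because h^n is an isometry, and the two mixed products supply the
    halves in b and c. *)
Lemma zint_operators (N N' N2 N2' P P2 : L) :
  P = N - H n N' -> P2 = N2 - H n N2' ->
  2^-1 * zint (mult (theta q m) P * P2) + zint (mult delta P * P2)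
  + 2^-1 * (zint (P * H n N2') - zint (P2 * H n N')) =
  zint (opa N * N2) + zint (opb N' * N2) - zint (opc N * N2') - zint (opd N' * N2').
Proof.
move=> PE P2E.
have zB (a b : L) : zint (a - b) = zint a - zint b by [].
have -> : 2^-1 * zint (mult (theta q m) P * P2) + zint (mult delta P * P2) =
    zint (opa P * P2).
  have opaE : laurentC 2^-1 * mult (theta q m) P + mult delta P = opa P.
    by apply: seriesP => k; rewrite laurentD laurentMCr /= /Theta; ring.
  by rewrite -zintZ mulrA -zintD -mulrDl opaE.
have g (a b c d : L) : zint ((a - b) * (c - d)) =
    zint (a * c) - zint (b * c) - (zint (a * d) - zint (b * d)).
  by rewrite mulrBr zB !mulrBl !zB.
have gC (a b v : L) : zint ((a - laurentC 2^-1 * b) * v) =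
    zint (a * v) - 2^-1 * zint (b * v).
  by rewrite mulrBl zB -mulrA zintZ.
have HV (X : L) : zint (X * H n N2') = zint (H (- n%:Z) X * N2') by exact: zintH.
have HHK (X : L) : H (- n%:Z) (H n X) = X by rewrite (HD q0) addNr H0.
have opaP : opa P = opa N - opa (H n N') by rewrite /opa PE raddfB.
have -> : opb N' = - opa (H n N') - laurentC 2^-1 * H n N'.
  by apply: seriesP => k; rewrite laurentD !laurentN laurentMCr /= /Theta; ring.
have qV k : (q ^ (- n%:Z)) ^ k = ((q ^ n) ^ k)^-1.
  by rewrite !exprz_exp mulNr -invr_expz.
have -> : opc N = H (- n%:Z) (opa N) - laurentC 2^-1 * H (- n%:Z) N.
  by apply: seriesP => k; rewrite laurentD !laurentN laurentMCr /= qV; ring.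
have -> : opd N' = - H (- n%:Z) (opa (H n N')).
  apply: seriesP => k; rewrite laurentN /= qV.
  by field; rewrite expfz_neq0// expfz_neq0.
pose z1 := zint (opa N * N2); pose z2 := zint (opa (H n N') * N2).
pose z3 := zint (H (- n%:Z) (opa N) * N2').
pose z4 := zint (H (- n%:Z) (opa (H n N')) * N2').
pose z5 := zint (H (- n%:Z) N * N2'); pose z6 := zint (N' * N2').
pose z7 := zint (H n N' * N2).
have -> : zint (opa P * P2) = z1 - z2 - (z3 - z4).
  by rewrite opaP P2E g (HV (opa N)) (HV (opa (H n N'))).
have -> : zint (P * H n N2') = z5 - z6.
  by rewrite HV PE raddfB /= HHK mulrBl zB.
have -> : zint (P2 * H n N') = z7 - z6.
  rewrite P2E mulrBl zB mulrC; congr (_ - _); rewrite mulrC HV HHK //.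
have -> : zint ((- opa (H n N') - laurentC 2^-1 * H n N') * N2) = - z2 - 2^-1 * z7.
  by rewrite gC mulNr.
have -> : zint ((H (- n%:Z) (opa N) - laurentC 2^-1 * H (- n%:Z) N) * N2') =
    z3 - 2^-1 * z5.
  exact: gC.
have -> : zint (- H (- n%:Z) (opa (H n N')) * N2') = - z4 by rewrite mulNr.
by rewrite -/z1; ring.
Qed.

End Multipliers.

End Reduction.

(** * Brackets and gradients on difference operators, and their invariant extensions *)

Section DSReduction.
Variables (R : realType) (q : R[i]) (m : nat).
Local Notation C := R[i].
Local Notation L := (laurent R).
Local Notation n := m.+1.
Local Notation gl := 'M[laurent R]_n.
Local Notation H i := (@dil R (q ^ i)).
Hypotheses (q_gt0 : 0 < `|q|) (q_lt1 : `|q| < 1).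
Implicit Types (F : psiD R) (G : gl).

Let q0 : q != 0. Proof. by rewrite -normr_gt0. Qed.

Local Notation suppF := (supported (fun i => - n%:Z < i <= 0)).

Lemma bracket_ME (a b c d : L -> L) phi psi B : Mspace n B ->
  let F := grad_M q n phi B in let F2 := grad_M q n psi B in
  suppF F -> suppF F2 ->
  let N := Nl q m B F in let N' := Nr q m F B in
  let N2 := Nl q m B F2 in let N2' := Nr q m F2 B in
  bracket_M q n a b c d phi psi B =
  2^-1 * (pair_plus q n N N2 - pair_plus q n N2 N)
  - 2^-1 * (pair_plus q n N' N2' - pair_plus q n N2' N')
  + (zint (a (N 0) * N2 0) + zint (b (N' 0) * N2 0)
     - zint (c (N 0) * N2' 0) - zint (d (N' 0) * N2' 0)).
Proof.
move=> MB; rewrite /bracket_M.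
move: (grad_M q n phi B) (grad_M q n psi B) => F F2 F0 F20; cbv zeta.
have Bout i : n%:Z < i -> B i = 0 by move=> ni; case: MB => _; apply; lia.
have lE X : suppF X -> coefs (psiM q B X) = Nl q m B X.
  by move=> X0; apply/funext => s; rewrite (psiM_grad_l q0 _ _ X0).
have rE X : suppF X -> coefs (psiM q X B) = Nr q m X B.
  by move=> X0; apply/funext => s; rewrite (psiM_grad_r q0 _ _ X0).
have lb X : suppF X -> forall i, n%:Z < i -> psiM q B X i = 0.
  move=> X0 i ni; rewrite lE// /Nl big1// => l _.
  by rewrite /Mterm Bout ?mul0r//; lia.
have rb X : suppF X -> forall i, n%:Z < i -> psiM q X B i = 0.
  move=> X0 i ni; rewrite rE// /Nr big1// => l _.
  by rewrite /Nterm Bout ?raddf0 ?mulr0//; lia.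
rewrite !(psi_pairingDl q0) !psi_pairing_0.
rewrite (psi_pairing_R q0 (lb _ F0) (lb _ F20)) (psi_pairing_R q0 (rb _ F0) (rb _ F20)).
rewrite (lE _ F0) (lE _ F20) (rE _ F0) (rE _ F20).
by ring.
Qed.

Lemma Yspace_companion (B : psiD R) : Yspace (companion n B : gl).
Proof. by move=> i j ji; rewrite mxE gtn_eqF//; lia. Qed.

Lemma rhoP (A : gl) : Yspace A ->
  Mspace n (rho q A) /\ exists2 S, LNplus S & gauge q S A = companion n (rho q A).
Proof.
move=> /(rho_exists q)[B [MB [S SN SA]]]; rewrite /rho.
by case: xgetP => [X _ //|/(_ B)[]]; split=> //; exists S.
Qed.

Lemma rho_companion B : Mspace n B -> rho q (companion n B) = B.
Proof.
move=> MB; have [MB' [S SN SE]] := rhoP (Yspace_companion B).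
have id1 : LNplus (1%:M : gl) by move=> i j ji; rewrite mxE.
have e1 : gauge q 1%:M (companion n B) = companion n B.
  by rewrite /gauge shift1 mul1mx invmx1 mulmx1.
exact: (rho_unique MB' MB SN id1 SE e1).
Qed.

Lemma psi_pairing_monomial (a : L) (k : nat) F :
  psi_pairing q (monomial a k) F = zint (a * H k (F (- k%:Z))).
Proof.
rewrite /psi_pairing /psi_trace /= (@fsum_supp _ [set k%:Z]).
  by rewrite fsbig_set1 eqxx sub0r.
by move=> i /eqP/negPf ->; rewrite mul0r.
Qed.

(** Varying only the first row keeps the line inside the companion matrices, where [hphi] is [phi];
    comparing the two derivatives determines the first column of G. *)
Lemma grad_companion (phi : psiD R -> C) (hphi : gl -> C) B F G :
  Mspace n B -> @extends R q n phi hphi ->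
  is_grad_M q n phi B F -> is_grad_gl hphi (companion n B) G ->
  extends_grad q F G.
Proof.
move=> MB [_ _ hphiE] [F0 FP] GP i; apply/eqP; rewrite -subr_eq0; apply/eqP.
apply: zint_eq0 => c; have im := ltn_ord i.
pose X : gl := c *: delta_mx ord0 i.
pose X' : psiD R := monomial (- c) (m - i)%N.
have suppX' : supported (fun i => 0 <= i < n%:Z) X'.
  by move=> k kn /=; rewrite ifF//; lia.
have [_ dG] := GP X; have [_ dF] := FP X' suppX'.
have fE : (fun t : C^o => hphi (companion n B + laurentC t *: X) : C^o) =
    (fun t : C^o => phi (B + (t : C) *: X') : C^o).
  apply/funext => t; have cE : companion n B + laurentC t *: X = companion n (B + (t : C) *: X').
    apply/matrixP => k j; rewrite [LHS]mxE 2![companion _ _ _ _]mxE [(laurentC t *: X) k j]mxE.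
    rewrite [X k j]mxE [delta_mx _ _ _ _]mxE -!val_eqE /=.
    have jm := ltn_ord j; case: eqVneq => [k0|_]; last by rewrite !mulr0 addr0.
    rewrite opprD; congr (_ + _); rewrite laurentZ.
    case: eqVneq => [ji|ji]; last by rewrite !mulr0 ifF ?mulr0 ?oppr0//; lia.
    by rewrite mulr1 ifT ?mulrN ?opprK// ji; lia.
  have X'Z k : ((t : C) *: X') k = laurentC t * X' k by exact: laurentZ.
  rewrite cE hphiE; last exact: Yspace_companion.
  rewrite rho_companion//; split.
    rewrite -[RHS](proj1 MB) -[RHS]addr0; congr (_ + _).
    by rewrite X'Z (_ : X' n = 0) ?mulr0// /X' /= ifF//; lia.
  move=> k kn; rewrite -[RHS]addr0; congr (_ + _).
    by case: MB => _; apply.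
  by rewrite X'Z suppX' ?mulr0//; lia.
have e : pairing G X = psi_pairing q X' F by rewrite -dG fE dF.
move: e; rewrite pairing_delta psi_pairing_monomial => e.
rewrite opprK mulrDl -[zint _]/(zint _ + zint _) e mulNr [X in _ + X]/(zint (_ * c)).
by rewrite mulrC -[zint (- _)]/(- zint _) addNr.
Qed.

End DSReduction.

(** * Reduction of the bracket for an arbitrary multiplier delta *)

Section BracketReduction.
Variables (R : realType) (q : R[i]) (m : nat).
Local Notation C := R[i].
Local Notation L := (laurent R).
Local Notation n := m.+1.
Local Notation gl := 'M[laurent R]_n.
Local Notation H i := (@dil R (q ^ i)).
Variable Delta : gl -> gl.
Hypotheses (q_gt0 : 0 < `|q|) (q_lt1 : `|q| < 1).
Variable delta : int -> C.
Hypothesis DeltaE : forall f, Delta (Ud q n f) = Ud q n (mult delta f).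

Let q0 : q != 0. Proof. by rewrite -normr_gt0. Qed.

Lemma grad_glP (phi : gl -> C) A : smooth_gl phi -> is_grad_gl phi A (grad_gl phi A).
Proof. by move=> /(_ A)[G GP]; rewrite /grad_gl; case: xgetP => [//|/(_ G)]. Qed.

Lemma grad_MP (phi : psiD R -> C) B : smooth_M q n phi -> Mspace n B ->
  is_grad_M q n phi B (grad_M q n phi B).
Proof. by move=> sp /sp[F FP]; rewrite /grad_M; case: xgetP => [//|/(_ F)]. Qed.

Lemma zint_mult_kap th B F F2 : Mspace n B ->
  zint (mult th (@kap R q m B F ord0) * @kap R q m B F2 ord0) =
  zint (mult th (Nl q m B F 0 - H n (Nr q m F B 0))
        * (Nl q m B F2 0 - H n (Nr q m F2 B 0))).
Proof.
move=> MB; rewrite -(kap0 q0 F MB) -(kap0 q0 F2 MB) -[LHS](zint_dil q) dilM//.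
have -> : dil q (mult th (@kap R q m B F ord0)) = mult th (dil q (@kap R q m B F ord0)).
  by apply: seriesP => k /=; rewrite mulrCA.
by [].
Qed.

Lemma bracket_reduction (phi psi : psiD R -> C) (hphi hpsi : gl -> C) A :
  smooth_M q n phi -> smooth_M q n psi ->
  extends q phi hphi -> extends q psi hpsi -> Yspace A ->
  bracket_gl q Delta hphi hpsi A =
  bracket_M q n (opa q m delta) (opb q m delta) (opc q m delta) (opd q m delta)
    phi psi (rho q A).
Proof.
move=> sphi spsi ephi epsi YA.
have [shphi iphi _] := ephi; have [shpsi ipsi _] := epsi.
have [MB [S SN SA]] := rhoP q YA.
have uS := LNplus_unit SN.
move: (rho q A) MB SA => B MB SA.
have FP := grad_MP sphi MB; have F2P := grad_MP spsi MB.
have GP := grad_glP A shphi; have G2P := grad_glP A shpsi.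
have uG := grad_diff_upper q0 iphi GP; have uG2 := grad_diff_upper q0 ipsi G2P.
rewrite (bracket_glE _ q_gt0 q_lt1 DeltaE uG uG2)//.
have GP' := grad_gauge q0 iphi SN GP; have G2P' := grad_gauge q0 ipsi SN G2P.
have dG := grad_diff_gauge q0 A (grad_gl hphi A) SN.
have dG2 := grad_diff_gauge q0 A (grad_gl hpsi A) SN.
have oE := omega_gauge q_gt0 A (grad_gl hphi A) (grad_gl hpsi A) SN uS.
move: oE dG dG2 GP' G2P'; rewrite SA.
move: (S *m grad_gl hphi A *m _) (S *m grad_gl hpsi A *m _) => G G2 oE dG dG2 GP' G2P'.
have uG' := grad_diff_upper q0 iphi GP'; have uG2' := grad_diff_upper q0 ipsi G2P'.
(* From here on the gradients are those transported to the companion matrix; the form depends only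
   on the diagonals of k and on [omega], and these are unchanged. *)
have kE i : grad_diff q (companion n B) G i i = grad_diff q A (grad_gl hphi A) i i.
  by rewrite dG; apply: (diag_conj SN uG _ uS); rewrite -dG.
have kE2 i : grad_diff q (companion n B) G2 i i = grad_diff q A (grad_gl hpsi A) i i.
  by rewrite dG2; apply: (diag_conj SN uG2 _ uS); rewrite -dG2.
have F0 := proj1 FP; have F20 := proj1 F2P.
have eF := grad_companion q_gt0 q_lt1 MB ephi FP GP'.
have eF2 := grad_companion q_gt0 q_lt1 MB epsi F2P G2P'.
have [a [pa _ _]] := grad_facts q_gt0 q_lt1 MB F0 eF uG'.
have [b [pb _ _]] := grad_facts q_gt0 q_lt1 MB F20 eF2 uG2'.
rewrite (@grad_form_congr _ q n isT q_gt0 q_lt1 delta _ _ _ _ _ _ a b pa pb kE kE2 oE).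
rewrite (grad_form_companion q_gt0 q_lt1 MB delta F0 F20 eF eF2 uG' uG2').
rewrite (omega_Ghat q_gt0 q_lt1 MB F0 F20).
rewrite (zint_mult_kap (theta q m) _ _ MB) (zint_mult_kap delta _ _ MB).
rewrite (bracket_ME q_gt0 q_lt1 _ _ _ _ MB F0 F20).
set F := grad_M q n phi B; set F2 := grad_M q n psi B.
pose P X := Nl q m B X 0 - H n (Nr q m X B 0).
move: (zint_operators q_gt0 delta (erefl (P F)) (erefl (P F2))) => <-; rewrite /P.
set z1 := zint _; set z2 := zint _; set z3 := zint _; set z4 := zint _.
set p1 := pair_plus _ _ _ _; set p2 := pair_plus _ _ _ _.
set p3 := pair_plus _ _ _ _; set p4 := pair_plus _ _ _ _.
move: z1 z2 z3 z4 p1 p2 p3 p4 => *; ring.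
Qed.

End BracketReduction.

(** * The operators a, b, c, d, and the determinant functional *)

Section Operators.
Variables (R : realType) (q : R[i]) (m : nat).
Local Notation C := R[i].
Local Notation L := (laurent R).
Local Notation n := m.+1.
Hypotheses (q_gt0 : 0 < `|q|) (q_lt1 : `|q| < 1).
Variable delta : int -> C.
Hypothesis delta_odd : forall k, delta (- k) = - delta k.

Let q0 : q != 0. Proof. by rewrite -normr_gt0. Qed.
Let qn0 k : (q ^ n) ^ k != 0. Proof. by rewrite !expfz_neq0. Qed.

Lemma qn_exprN k : (q ^ n) ^ (- k) = ((q ^ n) ^ k)^-1.
Proof. by rewrite invr_expz. Qed.

Lemma Theta_odd k : Theta q m delta (- k) = - Theta q m delta k.
Proof.
rewrite /Theta delta_odd opprD; congr (_ - _); rewrite -mulrN; congr (_ * _).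
rewrite /theta qn_exprN; have [->|k0] := eqVneq k 0.
  by rewrite expr0z invr1 subrr invr0 !mulr0 oppr0.
have := qn_expz_neq1 m q_lt1 k0; have := qn0 k.
move: ((q ^ n) ^ k) => x x0 x1; field.
by rewrite x0 x1 /= -opprB oppr_eq0 x1.
Qed.

Lemma opa_adjoint : adjoint (opa q m delta) (fun f => - opa q m delta f).
Proof.
move=> u v; rewrite /opa mult_adj; congr (zint (_ * _)).
by apply: seriesP => k; rewrite laurentN /= Theta_odd mulNr.
Qed.

Lemma opd_adjoint : adjoint (opd q m delta) (fun f => - opd q m delta f).
Proof.
move=> u v; rewrite /opd mult_adj; congr (zint (_ * _)).
by apply: seriesP => k; rewrite laurentN /= Theta_odd mulNr.
Qed.

Lemma opc_adjoint : adjoint (opc q m delta) (opb q m delta).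
Proof.
move=> u v; rewrite /opc mult_adj; congr (zint (_ * _)).
apply: seriesP => k; rewrite /= qn_exprN invrK Theta_odd; ring.
Qed.

(** With x = q^(n k), a + b - c - d acts as -Theta (1 - x)^2 / x + (1 - x^2) / (2 x); the part
    (1/2)(1 + x) / (1 - x) of Theta cancels the last term, so only delta survives. *)
Lemma operators_defect f k :
  (opa q m delta f + opb q m delta f - (opc q m delta f + opd q m delta f)) k =
  - delta k * (1 - (q ^ n) ^ k) ^+ 2 / (q ^ n) ^ k * f k.
Proof.
rewrite !laurentD laurentN laurentD /= /Theta /theta; have [->|k0] := eqVneq k 0.
  by rewrite expr0z subrr invr0 invr1; ring.
have := qn_expz_neq1 m q_lt1 k0; have := qn0 k.
move: ((q ^ n) ^ k) => x x0 x1; field.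
by rewrite x0 x1.
Qed.

End Operators.

Lemma coef1_prod_linear (K : comNzRingType) (I : finType) (r : seq I) (a : I -> K) :
  exists c : I -> K, forall b : I -> K,
    (\prod_(i <- r) ((a i)%:P + b i *: 'X))`_1 = \sum_i c i * b i.
Proof.
elim: r => [|i0 r [c cE]].
  exists (fun=> 0) => b; rewrite big_nil coef1 /= big1// => i _; exact: mul0r.
exists (fun i => a i0 * c i + (if i == i0 then \prod_(j <- r) a j else 0)) => b.
have q0 : (\prod_(i <- r) ((a i)%:P + b i *: 'X))`_0 = \prod_(j <- r) a j.
  rewrite -horner_coef0 horner_prod; apply: eq_bigr => i _.
  by rewrite !hornerE.
rewrite big_cons mulrDl coefD coefCM cE -scalerAl coefZ coefXM /= q0 mulr_sumr.
under [RHS]eq_bigr do rewrite mulrDl -mulrA.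
rewrite big_split /=; congr (_ + _).
rewrite (bigD1 i0)//= eqxx [X in _ + X]big1 ?addr0 1?mulrC// => i /negPf ->.
exact: mul0r.
Qed.

(** Jacobi's formula for the derivative of the determinant, with an unspecified G in place of the
    adjugate; each term of the Leibniz expansion has a linear coefficient that is linear in X. *)
Lemma det_coef1_linear (K : comNzRingType) (n : nat) (A : 'M[K]_n) :
  exists G : 'M[K]_n, forall X : 'M[K]_n,
    (\det (map_mx polyC A + 'X *: map_mx polyC X))`_1 = \tr (G *m X).
Proof.
have /choice[c cE] : forall s : 'S_n, exists c : 'I_n -> K, forall b : 'I_n -> K,
    (\prod_i ((A i (s i))%:P + b i *: 'X))`_1 = \sum_i c i * b i.
  by move=> s; exact: (coef1_prod_linear _ (fun i => A i (s i))).
exists (\matrix_(j, i) \sum_(s : 'S_n | s i == j) (-1) ^+ s * c s i) => X.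
rewrite /determinant coef_sum.
transitivity (\sum_(s : 'S_n) (-1) ^+ s * \sum_i c s i * X i (s i)).
  apply: eq_bigr => s _; rewrite -cE.
  rewrite -(rmorph_sign (@polyC K)) coefCM; congr (_ * (_ : {poly K})`_1).
  by apply: eq_bigr => i _; rewrite !mxE mulrC mul_polyC.
under eq_bigr do rewrite mulr_sumr.
rewrite exchange_big /mxtrace /=.
transitivity (\sum_i \sum_j (\sum_(s : 'S_n | s i == j) (-1) ^+ s * c s i) * X i j).
  apply: eq_bigr => i _; rewrite (partition_big (fun s : 'S_n => s i) xpredT)//=.
  apply: eq_bigr => j _; rewrite mulr_suml; apply: eq_bigr => s /eqP <-.
  by rewrite mulrA.
rewrite exchange_big; apply: eq_bigr => j _; rewrite mxE; apply: eq_bigr => i _.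
by rewrite mxE.
Qed.

Lemma is_derive_horner (K : numFieldType) (p : {poly K}) (x : K^o) :
  is_derive x (1 : K^o) (fun t : K^o => p.[t] : K^o) p^`().[x].
Proof.
elim/poly_ind: p => [|p c IH].
  rewrite linear0 horner0 (_ : (fun t => _) = cst 0).
    exact: is_derive_cst.
  by apply/funext => t; rewrite horner0.
rewrite (_ : (fun t : K^o => _) = (fun t : K^o => p.[t] : K^o) * id + cst c); last first.
  by apply/funext => t; rewrite !hornerE.
have := @is_deriveD K K^o K^o _ _ _ _ _ _
  (@is_deriveM K K^o _ _ _ _ _ _ IH (is_derive_id x 1)) (is_derive_cst c x 1).
suff -> : (p * 'X + c%:P)^`().[x] = p.[x] *: (1 : K^o) + x *: p^`().[x] + 0 by [].
by rewrite derivD derivC addr0 derivM derivX !hornerE /GRing.scale /=; ring.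
Qed.

Section Determinant.
Variables (R : realType) (q : R[i]) (m : nat).
Local Notation C := R[i].
Local Notation L := (laurent R).
Local Notation n := m.+1.
Local Notation gl := 'M[laurent R]_n.
Hypotheses (q_gt0 : 0 < `|q|) (q_lt1 : `|q| < 1).

Let q0 : q != 0. Proof. by rewrite -normr_gt0. Qed.

(** The determinant along a line is a polynomial in t over L, while smoothness concerns functions of
    t in C; integrating the coefficients against f gives an ordinary complex polynomial. *)
Lemma zint_horner (f : L) (P : {poly L}) (t : C) :
  zint (f * P.[laurentC t]) = (\poly_(i < size P) zint (f * P`_i)).[t].
Proof.
rewrite horner_poly horner_coef mulr_sumr zint_sum; apply: eq_bigr => i _.
have -> : laurentC t ^+ i = laurentC (t ^+ i) :> L.
  by elim: (i : nat) => [//|k IH]; rewrite exprS IH -laurentCM -exprS.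
by rewrite mulrA [_ * laurentC _]mulrC zintZ mulrC.
Qed.

Lemma is_derive_zint_horner (f : L) (P : {poly L}) :
  is_derive (0 : C^o) (1 : C^o) (fun t : C^o => zint (f * P.[laurentC t]) : C^o)
    (zint (f * P`_1)).
Proof.
rewrite (_ : (fun t : C^o => _) =
   (fun t : C^o => (\poly_(i < size P) zint (f * P`_i)).[t] : C^o)); last first.
  by apply/funext => t; exact: zint_horner.
have := is_derive_horner (\poly_(i < size P) zint (f * P`_i)) 0.
rewrite horner_coef0 coef_deriv mulr1n coef_poly.
case: ltnP => // P1; rewrite (_ : zint (f * P`_1) = 0)//.
by rewrite nth_default// mulr0.
Qed.

Definition det_functional (f : L) (A : gl) : C := (-1) ^+ n * zint (f * \det A).

Lemma smooth_det_functional f : smooth_gl (det_functional f).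
Proof.
move=> A; have [G GE] := det_coef1_linear A.
pose f' := laurentC ((-1) ^+ n) * f; exists (f' *: G) => X.
have -> : pairing (f' *: G) X =
    zint (f' * (\det (map_mx polyC A + 'X *: map_mx polyC X))`_1).
  by rewrite /pairing -scalemxAl mxtraceZ GE.
rewrite (_ : (fun t : C^o => _) = (fun t : C^o =>
    zint (f' * (\det (map_mx polyC A + 'X *: map_mx polyC X)).[laurentC t]) : C^o)).
  exact: is_derive_zint_horner.
apply/funext => t; rewrite /det_functional /f' -mulrA zintZ; congr (_ * zint (_ * _)).
rewrite -horner_evalE -det_map_mx; congr (\det _).
by apply/matrixP => i j; rewrite !mxE /= horner_evalE !hornerE.
Qed.

Lemma det_LNplus (S : gl) : LNplus S -> \det S = 1.
Proof.
move=> SN; rewrite -det_tr det_trig.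
  by rewrite big1// => i _; rewrite mxE SN ?eqxx.
apply/is_trig_mxP => i j ij; rewrite mxE SN 1?ltnW//.
by rewrite -val_eqE gtn_eqF.
Qed.

Lemma invariant_det_functional f : gauge_invariant q (det_functional f).
Proof.
move=> S A SN; have hSN : LNplus (shift q S).
  by move=> i j ji; rewrite mxE SN//; case: eqP => _; rewrite ?dil1 ?raddf0.
rewrite /det_functional /gauge !det_mulmx det_inv (det_LNplus SN) (det_LNplus hSN).
by rewrite invr1 mulr1 mul1r.
Qed.

Lemma det_companion (B : psiD R) : \det (companion n B) = (-1) ^+ n * B 0.
Proof.
rewrite (expand_det_col _ ord_max) big_ord_recl big1 ?addr0 => [|i _]; last first.
  rewrite mxE /= /bump /= add1n eqSS (_ : (_ == _) = false) ?mul0r//.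
  by have := ltn_ord i; lia.
rewrite mxE /= (_ : n%:Z - m%:Z - 1 = 0); last by lia.
rewrite /cofactor (_ : row' _ _ = 1%:M) ?det1 ?mulr1 /=; last first.
  apply/matrixP => i j; rewrite !mxE /= /bump /= add1n eqSS.
  by rewrite leqNgt ltn_ord add0n.
by rewrite add0n exprS !mulNr mul1r mulrC.
Qed.

Definition coef0_functional (f : L) (B : psiD R) : C := zint (f * B 0).

Lemma coef0_derive f B X : is_derive (0 : C^o) (1 : C^o)
  (fun t : C^o => coef0_functional f (B + (t : C) *: X) : C^o) (zint (f * X 0)).
Proof.
have := is_derive_zint_horner f ((B 0)%:P + (X 0)%:P * 'X).
rewrite coefD coefC coefMX coefC add0r /=.
rewrite (_ : (fun t : C^o => _) =
  (fun t : C^o => coef0_functional f (B + (t : C) *: X) : C^o))//.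
apply/funext => t; rewrite /coef0_functional !hornerE; congr (zint (_ * (_ + _))).
by rewrite mulrC; apply/esym; exact: laurentZ.
Qed.

Lemma smooth_coef0 f : smooth_M q n (coef0_functional f).
Proof.
move=> B _; exists (monomial f 0); split=> [i i0 /=|X _].
  by rewrite ifF//; lia.
have -> : psi_pairing q X (monomial f 0) = zint (f * X 0).
  rewrite /psi_pairing /psi_trace /= (@fsum_supp _ [set 0 : int]).
    by rewrite fsbig_set1 subrr eqxx (H0 q) mulrC.
  by move=> i /eqP i0; rewrite ifF ?raddf0 ?mulr0//; lia.
exact: coef0_derive.
Qed.

Lemma extends_det f : extends q (coef0_functional f) (det_functional f).
Proof.
split; [exact: smooth_det_functional|exact: invariant_det_functional|move=> A YA].
have [MB [S SN SA]] := rhoP q YA.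
rewrite -(invariant_det_functional f A SN) SA /det_functional det_companion.
rewrite /coef0_functional mulrA [f * _]mulrC -mulrA.
have -> : (-1) ^+ n = laurentC ((-1) ^+ n) :> L.
  by elim: (n) => [//|k IH]; rewrite !exprS IH laurentCM laurentCN.
by rewrite zintZ mulrA -exprMn mulrNN mulr1 expr1n mul1r.
Qed.

Lemma grad_coef0 f B : Mspace n B -> grad_M q n (coef0_functional f) B 0 = f.
Proof.
move=> MB; have [F0 FP] := grad_MP (smooth_coef0 f) MB.
apply/eqP; rewrite -subr_eq0; apply/eqP/zint_eq0 => x.
have suppX : supported (fun i => 0 <= i < n%:Z) (monomial x 0).
  by move=> i i0 /=; rewrite ifF//; lia.
have [_ e] := FP _ suppX; have [_ e'] := coef0_derive f B (monomial x 0).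
move: e; rewrite e' (psi_pairing_monomial q x 0) oppr0 H0 /= => e.
by rewrite mulrBl -[zint _]/(zint _ - zint _) e mulrC subrr.
Qed.

End Determinant.

(** * The two directions of the equivalence *)

Section Conclusion.
Variables (R : realType) (q : R[i]) (m : nat).
Local Notation C := R[i].
Local Notation L := (laurent R).
Local Notation n := m.+1.
Local Notation gl := 'M[laurent R]_n.
Variable Delta : gl -> gl.
Hypotheses (q_gt0 : 0 < `|q|) (q_lt1 : `|q| < 1).

Let q0 : q != 0. Proof. by rewrite -normr_gt0. Qed.

(* At [D^n + 1] the zeroth coefficients of [B F] and [F B] are both [F 0]. *)
Lemma bracket_M_Dn1 (f g : L) :
  let B : psiD R := monomial 1 n + monomial 1 0 in
  Mspace n B /\ exists K : C, forall a b c d : L -> L,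
  bracket_M q n a b c d (coef0_functional f) (coef0_functional g) B =
  K + zint ((a f + b f - (c f + d f)) * g).
Proof.
move=> B; have MB : Mspace n B.
  split; first by rewrite /B /= eqxx addr0.
  by move=> i ni; rewrite /B /= !ifF ?addr0//; lia.
split=> //; have B0 : B 0 = 1 by rewrite /B /= add0r.
have Bl (l : 'I_m) : B (0 + (lift ord0 l)%:Z) = 0.
  have := ltn_ord l; rewrite /B lift0 /= => lm.
  by rewrite !ifF ?addr0//; lia.
have NlE F : Nl q m B F 0 = F 0.
  rewrite /Nl big_ord_recl big1 ?addr0 => [|l _]; rewrite /Mterm.
    by rewrite add0r B0 mul1r oppr0 H0.
  by rewrite Bl mul0r.
have NrE F : Nr q m F B 0 = F 0.
  rewrite /Nr big_ord_recl big1 ?addr0 => [|l _]; rewrite /Nterm.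
    by rewrite add0r B0 dil1 mulr1 oppr0.
  by rewrite Bl raddf0 mulr0.
have [F0 _] := grad_MP (smooth_coef0 q_gt0 q_lt1 f) MB.
have [F20 _] := grad_MP (smooth_coef0 q_gt0 q_lt1 g) MB.
eexists => a b c d; rewrite (bracket_ME q_gt0 q_lt1 _ _ _ _ MB F0 F20).
rewrite !NlE !NrE !grad_coef0//; congr (_ + _).
by rewrite mulrBl !mulrDl -[zint (_ - _)]/(zint _ + zint _ - (zint _ + zint _)) opprD addrA.
Qed.

Lemma zero_reduces : (forall A, Uspace q A -> Delta A = 0) ->
  reduces_to_involutive q Delta.
Proof.
move=> D0; pose delta0 (k : int) : C := 0.
have delta0_odd k : delta0 (- k) = - delta0 k by rewrite oppr0.
have DE f : Delta (Ud q n f) = Ud q n (mult delta0 f).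
  rewrite D0; last exact: Ud_Uspace.
  apply/matrixP => i j; rewrite !mxE (_ : mult delta0 f = 0) ?raddf0 ?mul0rn//.
  by apply: seriesP => k; rewrite /= mul0r.
exists (bracket_M q n (opa q m delta0) (opb q m delta0) (opc q m delta0) (opd q m delta0)).
  move=> phi psi hphi hpsi sphi spsi ephi epsi A YA.
  by rewrite (bracket_reduction q_gt0 q_lt1 DE sphi spsi ephi epsi YA).
exists (mult (Theta q m delta0)), (mult (fun k => - (q ^ n) ^ k * (Theta q m delta0 k + 2^-1))),
  (mult (fun k => ((q ^ n) ^ k)^-1 * (Theta q m delta0 k - 2^-1))),
  (mult (fun k => - Theta q m delta0 k)).
split=> //.
- exact: opa_adjoint.
- exact: opd_adjoint.
- exact: opc_adjoint.
move=> f; apply/eqP; rewrite -subr_eq0; apply/eqP/seriesP => k.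
by rewrite operators_defect// oppr0 !mul0r.
Qed.

Lemma reduces_zero : operator_in_U q Delta -> skew_in_U q Delta ->
  commutes_with_shift_in_U q Delta ->
  reduces_to_involutive q Delta -> forall A, Uspace q A -> Delta A = 0.
Proof.
move=> DU Dskew Dshift [br DSbr [a [b [c [d [_ _ _ abcd brE]]]]]].
have [delta delta_odd DE] := Delta_mult (ltn0Sn m) q_gt0 q_lt1 DU Dskew Dshift.
suff delta0 k : delta k = 0.
  move=> _ [f _ <-]; rewrite -/(Ud q n f) DE.
  apply/matrixP => i j; rewrite !mxE (_ : mult delta f = 0) ?raddf0 ?mul0rn//.
  by apply: seriesP => k; rewrite /= delta0 mul0r.
have defect f : opa q m delta f + opb q m delta f -
    (opc q m delta f + opd q m delta f) = 0.
  (* [K] does not depend on the four operators, so the hypothetical a, b, c, d and the computed ones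
     can be compared at the single point D^n + 1; the former have defect 0 by involutivity. *)
  apply: zint_eq0 => g; have [MB [K KE]] := bracket_M_Dn1 f g.
  move: MB KE; set B := _ + _ => MB KE.
  have YB : Yspace (companion n B : gl) := Yspace_companion q_gt0 q_lt1 B.
  have sf := @smooth_coef0 R q m q_gt0 q_lt1 f.
  have sg := @smooth_coef0 R q m q_gt0 q_lt1 g.
  have ef := @extends_det R q m q_gt0 q_lt1 f.
  have eg := @extends_det R q m q_gt0 q_lt1 g.
  have := DSbr _ _ _ _ sf sg ef eg _ YB.
  rewrite (bracket_reduction q_gt0 q_lt1 DE sf sg ef eg YB) rho_companion//.
  rewrite brE// !KE abcd subrr mul0r => /addrI e.
  by rewrite -e.
(* For k = 0 the factor 1 - q^(n k) vanishes, so oddness of [delta] is used; for k <> 0 the factor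
   is invertible and the defect decides. *)
have [->|k0] := eqVneq k 0.
  have := delta_odd 0; rewrite oppr0 => /eqP.
  by rewrite -addr_eq0 -mulr2n mulrn_eq0 => /eqP.
have := operators_defect m q_gt0 q_lt1 delta (monomial (1 : C^o) k) k.
rewrite defect /= eqxx mulr1 => /esym/eqP.
rewrite mulNr mulNr oppr_eq0 !mulf_eq0 invr_eq0 (negPf (expfz_neq0 _ (expfz_neq0 _ q0))).
by rewrite orbF (negPf (qn_expz_neq1 m q_lt1 k0)) !orbF => /eqP.
Qed.

End Conclusion.

Theorem theorem2p11 (R : realType) (q : R[i]) (n : nat)
    (Delta : 'M[laurent R]_n -> 'M[laurent R]_n) :
  0 < `|q| -> `|q| < 1 -> (0 < n)%N ->
  operator_in_U q Delta -> skew_in_U q Delta ->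
  commutes_with_shift_in_U q Delta ->
  (reduces_to_involutive q Delta <-> forall A, Uspace q A -> Delta A = 0).
Proof.
case: n Delta => // m Delta q_gt0 q_lt1 _ DU Dskew Dshift.
split; first exact: reduces_zero.
exact: zero_reduces.
Qed.
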